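(* The space of triples of complex numbers $\{z_1,z_2,z_3\}$ which are not an arithmetic progression is a $K(\pi,1)$ space.
   Context: A triple $\{z_1,z_2,z_3\}$ is an unordered configuration of three distinct complex numbers, i.e. a point of $\mathcal{C}_3=\mathcal{F}_3/\Sigma_3$, where $\mathcal{F}_3\subset\mathbb{C}^3$ is the space of ordered triples of distinct points. It is an arithmetic progression if one of the three numbers is the midpoint of the other two, i.e. $z_i+z_j=2z_k$ for some $\{i,j,k\}=\{1,2,3\}$. The space in question has the subspace topology from $\mathcal{C}_3$. A $K(\pi,1)$ space is a connected space whose only possibly nontrivial homotopy group is its fundamental group. *)

(* Defs.v *)
From HB Require Import structures.
From mathcomp Require Import all_boot all_order all_algebra all_fingroup.
From mathcomp Require Import generic_quotient complex.
From mathcomp Require Import all_classical all_reals all_analysis.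

Set Implicit Arguments.
Unset Strict Implicit.
Unset Printing Implicit Defensive.
Import Order.TTheory GRing.Theory Num.Theory.
Import numFieldNormedType.Exports.

Local Open Scope classical_set_scope.
Local Open Scope ring_scope.
Local Open Scope quotient_scope.

Section HomotopyGroups.
Variable R : realType.

Definition cube n : set 'rV[R]_n := [set t | forall i, 0 <= t 0 i <= 1].
Arguments cube n : clear implicits.

Definition cube_boundary n : set (cube n) :=
  [set t : cube n | exists i, set_val t 0 i = 0 \/ set_val t 0 i = 1].

Definition unit_itv : set R := `[0, 1]%classic.

Variable X : topologicalType.

Definition spheroid n (x0 : X) : set (cube n -> X) :=
  [set f | continuous f /\ forall t, cube_boundary t -> f t = x0].

(* Homotopy through spheroids, i.e. relative to the boundary of the cube. *)
Definition spheroid_homotopic n (x0 : X) (f g : cube n -> X) : Prop :=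
  exists H : cube n * unit_itv -> X,
    [/\ continuous H,
        forall t s, set_val s = 0 -> H (t, s) = f t,
        forall t s, set_val s = 1 -> H (t, s) = g t
      & forall t s, cube_boundary t -> H (t, s) = x0].

Definition spheroid_class n (x0 : X) (f : cube n -> X) : set (cube n -> X) :=
  [set g | spheroid x0 g /\ spheroid_homotopic x0 f g].

(* The underlying set of the n-th homotopy group of (X, x0): spheroids are
   maps of pairs from the cube and its boundary to X and x0. The group law is
   left out, as a group is trivial iff its underlying set has one element. *)
Definition homotopy_group n (x0 : X) : set (set (cube n -> X)) :=
  [set spheroid_class x0 f | f in spheroid x0].
Arguments homotopy_group : clear implicits.

(* The class of the constant map is the neutral element. *)
Definition trivial_homotopy_group n (x0 : X) : Prop :=
  homotopy_group n x0 = [set spheroid_class x0 (fun=> x0)].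
Arguments trivial_homotopy_group : clear implicits.

(* A nonempty connected space with trivial higher homotopy groups (at every
   base point); [connected set0] holds, so nonemptiness is required. *)
Definition is_K_pi_1 : Prop :=
  [/\ [set: X] !=set0, connected [set: X]
    & forall n (x0 : X), (2 <= n)%N -> trivial_homotopy_group n x0].

End HomotopyGroups.
Arguments cube : clear implicits.

Section Configurations.
Variables (R : realType) (n : nat).

(* [R[i]^o] is R[i] with the topology of its norm. *)
Definition ordered_config : set 'rV[R[i]^o]_n := [set z : 'rV_n | injective (z 0)].

Definition same_config (z w : ordered_config) : bool :=
  [exists s : 'S_n, set_val w == col_perm s (set_val z)].

Lemma same_config_refl : reflexive same_config.
Proof. by move=> z; apply/existsP; exists 1%g; rewrite col_perm1. Qed.

Lemma same_config_sym : symmetric same_config.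
Proof.
suff h z w : same_config z w -> same_config w z by move=> z w; apply/idP/idP => /h.
move=> /existsP[s /eqP zw]; apply/existsP; exists s^-1%g; rewrite zw.
by rewrite -col_permM mulVg col_perm1.
Qed.

Lemma same_config_trans : transitive same_config.
Proof.
move=> w z v /existsP[s /eqP zw] /existsP[s' /eqP wv].
by apply/existsP; exists (s' * s)%g; rewrite wv zw col_permM.
Qed.

Definition same_config_equiv :=
  EquivRel same_config same_config_refl same_config_sym same_config_trans.

Definition config := {eq_quot same_config_equiv}.

HB.instance Definition _ := Quotient.on config.
HB.instance Definition _ := Topological.copy config (quotient_topology config).

End Configurations.
Arguments ordered_config : clear implicits.

(* Being an arithmetic progression does not depend on the chosen ordering z. *)
Definition arithmetic_progression (R : realType) : set (config R 3) :=
  [set c | exists z : ordered_config R 3, c = \pi_(config R 3) z /\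
    exists i j k, uniq [:: i; j; k] /\
      set_val z 0 i + set_val z 0 j = 2 * set_val z 0 k].

Definition non_AP_triples (R : realType) : topologicalType :=
  set_type (~` @arithmetic_progression R).

(* Main.v *)
Require Import Defs.
From mathcomp Require Import all_boot all_order all_algebra.
From mathcomp Require Import all_fingroup generic_quotient complex.
From mathcomp Require Import all_classical all_reals all_analysis.
From mathcomp Require Import ring lra.

Set Implicit Arguments.
Unset Strict Implicit.
Unset Printing Implicit Defensive.
Import Order.TTheory GRing.Theory Num.Theory.
Import numFieldNormedType.Exports.

Local Open Scope classical_set_scope.
Local Open Scope ring_scope.
Local Open Scope quotient_scope.

(* Translating the midpoint of two of the points to the origin and dividing by
   their half difference [g] turns an ordered triple into a midpoint in [C], a
   number [g] in [C \ {0}], and [3 t] for a number [t] in the complement of the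
   real points [0], [1/3], [-1/3], [1], [-1] of the plane. So ordering the
   points, writing [g] as an exponential, and passing to the universal cover of
   this punctured plane gives a covering of the space of triples.

   Elliptic coordinates with foci [1] and [-1] identify the closed upper half
   plane, without the punctures, with an ideal hexagon, convex without its
   vertices; the punctured plane is two copies of it glued along their sides.
   Its universal cover is therefore tiled by the images of the hexagon under the
   group generated by the reflections in its sides, a free product of six groups
   of order two. Realized linearly in [R^3], these images form a convex (Tits)
   cone, by ping-pong on reduced words; the scale is the only superfluous
   parameter. Two spheroids at the same point, lifted to this convex set with the
   same value on the boundary, are homotopic along line segments. *)

(** * Covering maps and lifting of cubes *)

Lemma near_gt0 (R : realType) (T : topologicalType) (f : T -> R) x :
  {for x, continuous f} -> 0 < f x -> \forall y \near x, 0 < f y.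
Proof. by move=> fc fx; exact: cvgr_gt fx. Qed.

Lemma pair_continuous_at (S T U : topologicalType) (f : S -> T) (g : S -> U) x :
  {for x, continuous f} -> {for x, continuous g} ->
  {for x, continuous (fun y => (f y, g y))}.
Proof. by move=> fc gc; exact: (cvg_pair fc gc). Qed.

Lemma row_continuous_at (S T : topologicalType) n (f : S -> 'rV[T]_n) x :
  (forall i, {for x, continuous (fun y => f y 0 i)}) -> {for x, continuous f}.
Proof.
move=> fc V [P xP PV].
have : \forall y \near x, forall i, P 0 i (f y 0 i).
  by apply: filter_forall => i; exact: (fc i _ (xP 0 i)).
by apply: filterS => y Py; apply: PV => i j; rewrite ord1.
Qed.

Lemma row_coord_continuous (T : topologicalType) n (i : 'I_n) :
  continuous (fun v : 'rV[T]_n => v 0 i).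
Proof.
move=> v S vS; exists (fun _ j => if j == i then S else setT).
  by move=> k j; case: eqP => [->|_]; [rewrite (ord1 k)|exact: filterT].
by move=> w /(_ 0 i); rewrite eqxx.
Qed.

(* The total space [A] and the base [O] are sets in [E] and [B], so that [p] and
   its local sections can be total functions. *)
Section Covering.
Variables (E B : topologicalType) (A : set E) (O : set B) (p : E -> B).

(** The last clause makes [s] a two-sided inverse of [p] near [e]: the image of [s] contains all
    points of [A] close to [e]. *)
Definition local_section (U : set B) (e : E) (s : B -> E) : Prop :=
  [/\ forall b, U b -> [/\ A (s b), p (s b) = b & {for b, continuous s}],
      s (p e) = e & \forall e' \near e, A e' -> s (p e') = e'].

(** The evenly covered [U] is fixed before the point [e] above it. This uniformity over the fibre,
    which a local homeomorphism need not have, is what lets lifts extend across the whole cube. *)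
Definition covering : Prop := forall b, O b -> exists2 U, open_nbhs b U &
  forall e, A e -> U (p e) -> exists s, local_section U e s.

Hypotheses (E_hausdorff : hausdorff_space E) (p_cov : covering).

(** The set of agreement is clopen in [J]: near a point of agreement one local section recovers both
    lifts from their common projection, and agreement is a closed condition since [E] is
    Hausdorff. *)
Lemma lift_unique (T : topologicalType) (J : set T) (g h : T -> E) (t0 : T) :
  connected J ->
  (forall t, J t -> [/\ A (g t), O (p (g t)) & {for t, continuous g}]) ->
  (forall t, J t -> [/\ A (h t), p (h t) = p (g t) & {for t, continuous h}]) ->
  J t0 -> g t0 = h t0 -> forall t, J t -> g t = h t.
Proof.
move=> Jc gP hP Jt0 gh0.
suff <- : [set t | J t /\ g t = h t] = J by move=> t [].
apply: Jc; first by exists t0.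
(* Openness is relative to [J]: the trace on [J] of this open set of [T] is the set of agreement. *)
- exists (interior [set t | J t -> g t = h t]); first exact: open_interior.
  apply/seteqP; split=> t [Jt].
    move=> ght; split=> //.
    have [Ag Og gc] := gP t Jt; have [Ah pgh hc] := hP t Jt.
    have [U [_ Ub] Us] := p_cov Og.
    have [s [_ _ sE]] := Us _ Ag Ub.
    have gs : \forall t' \near t, A (g t') -> s (p (g t')) = g t' := gc _ sE.
    have sE' : \forall e' \near h t, A e' -> s (p e') = e' by rewrite -ght.
    have hs : \forall t' \near t, A (h t') -> s (p (h t')) = h t' := hc _ sE'.
    apply: filterS2 gs hs => t' gs hs Jt'.
    have [Ag' _ _] := gP t' Jt'; have [Ah' pgh' _] := hP t' Jt'.
    by rewrite -(gs Ag') -(hs Ah') pgh'.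
  by move=> /nbhs_singleton /(_ Jt).
- exists (closure [set t | J t /\ g t = h t]); first exact: closed_closure.
  apply/seteqP; split=> t [Jt].
    by move=> ght; split=> //; exact: subset_closure.
  move=> clt; split=> //; apply: E_hausdorff => P Q gP' hQ.
  have [_ _ gc] := gP t Jt; have [_ _ hc] := hP t Jt.
  have gn : nbhs t (g @^-1` P) := gc _ gP'.
  have hn : nbhs t (h @^-1` Q) := hc _ hQ.
  have [t' [[Jt' ght'] [Pt' Qt']]] := clt _ (filterI gn hn).
  by exists (g t'); split=> //; rewrite ght'.
Qed.

(** * Lifting maps of the cube *)

Section CubeLifting.
Variables (R : realType) (n : nat).
Implicit Types t : 'rV[R]_n.

(** A retraction onto the cube, by which maps on the cube become maps of all row vectors. *)
Definition clamp t : 'rV[R]_n := \row_i Num.max 0 (Num.min 1 (t 0 i)).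

Lemma clamp_continuous : continuous clamp.
Proof.
move=> t; apply: row_continuous_at => i.
rewrite (_ : (fun _ => _) = fun t : 'rV_n => Num.max 0 (Num.min 1 (t 0 i))); last first.
  by apply/funext => u; rewrite mxE.
apply: (@continuous_max _ _ (cst 0) (fun t => Num.min 1 (t 0 i))).
  exact: cst_continuous.
apply: (@continuous_min _ _ (cst 1) (fun t => t 0 i)); first exact: cst_continuous.
exact: row_coord_continuous.
Qed.

Lemma clamp_cube t : cube R n (clamp t).
Proof. by move=> i; rewrite mxE le_max lexx ge_max ler01 ge_min lexx. Qed.

Lemma clamp_id t : cube R n t -> clamp t = t.
Proof.
by move=> tP; apply/rowP => i; have /andP[t0 t1] := tP i; rewrite mxE min_r ?max_r.
Qed.

Lemma cubeZ (r : R) t : 0 <= r <= 1 -> cube R n t -> cube R n (r *: t).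
Proof.
move=> /andP[r0 r1] tP i; rewrite mxE; have /andP[t0 t1] := tP i.
by rewrite mulr_ge0//= mulr_ile1.
Qed.

Lemma cube0 : cube R n 0.
Proof. by move=> i; rewrite mxE lexx ler01. Qed.

Lemma cube_compact : compact (cube R n).
Proof.
rewrite (_ : cube R n = [set t | forall i, `[0, 1]%classic (t ord0 i)]).
  exact: (@rV_compact R n (fun=> `[0, 1]%classic) (fun=> @segment_compact R 0 1)).
by apply/seteqP; split=> t tP i; have := tP i; rewrite /= in_itv.
Qed.

(** A Lebesgue number: compactness turns the evenly covered neighbourhoods of single points into
    balls of one common radius. *)
Lemma cube_lebesgue (f : 'rV[R]_n -> B) : continuous f ->
  (forall t, cube R n t -> O (f t)) -> exists2 d : R, 0 < d &
  forall t, cube R n t -> exists b, exists U : set B, [/\ open U, U b,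
    (forall t', ball t d t' -> U (f t')) &
    forall e, A e -> U (p e) -> exists s, local_section U e s].
Proof.
move=> fc fO.
have /compact_near_coveringP cov := cube_compact.
pose P (d : R) t := exists b, exists U : set B, [/\ open U, U b,
    (forall t', ball t d t' -> U (f t')) &
    forall e, A e -> U (p e) -> exists s, local_section U e s].
have dP : \forall d \near (0 : R)^'+, cube R n `<=` P d.
  apply: cov => t Kt; have [U [oU Uf] Us] := p_cov (fO t Kt).
  have /nbhs_ballP[e /= e0 eU] : nbhs t (f @^-1` U).
    exact: (fc t U (open_nbhs_nbhs (conj oU Uf))).
  exists (ball t (e / 2), [set d | 0 < d < e / 2]).
    split; first by apply: nbhsx_ballx; rewrite divr_gt0.
    by near=> d; apply/andP; split; near: d;
      [exact: nbhs_right_gt|apply: nbhs_right_lt; rewrite divr_gt0].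
  move=> [t' d] /= [tt' /andP[_ de]]; exists (f t), U; split=> // u t'u.
  apply: eU; rewrite [e]splitr; apply: ball_triangle tt' _.
  exact: le_ball (ltW de) _ t'u.
near (0 : R)^'+ => d; exists d => // t Kt.
by apply: (near dP d) => //.
Unshelve. all: by end_near. Qed.

(** The cube is contracted to its corner [0]: the maps sending [t] to [f (r *: clamp t)] are lifted
    for [r] running from 0 to 1 in steps shorter than a Lebesgue number, the first map being
    constant. Each step follows, at every [t], the local section through the lift found so far. *)
Theorem cube_lift (f : 'rV[R]_n -> B) (e0 : E) : continuous f ->
    (forall t, cube R n t -> O (f t)) -> A e0 -> p e0 = f 0 ->
  exists G : 'rV[R]_n -> E, [/\ continuous G, forall t, A (G t),
    forall t, p (G t) = f (clamp t) & G 0 = e0].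
Proof.
move=> fc fO Ae0 pe0.
have [d d0 dP] := cube_lebesgue fc fO.
have [N /= Nd] : exists N, N.+1%:R^-1 < d.
  by exists (Num.trunc d^-1); rewrite invf_plt ?posrE// truncnS_gt.
pose r k : R := k%:R / N.+1%:R.
have r01 k : (k <= N.+1)%N -> 0 <= r k <= 1.
  by move=> kN; rewrite divr_ge0//= ler_pdivrMr// mul1r ler_nat.
have rS k : r k.+1 = r k + N.+1%:R^-1 by rewrite /r -natr1 mulrDl mul1r.
suff lift k : (k <= N.+1)%N -> exists G : 'rV[R]_n -> E, [/\ continuous G,
    forall t, A (G t), forall t, p (G t) = f (r k *: clamp t) & G 0 = e0].
  have [G [Gc GA pG G0]] := lift N.+1 (leqnn _).
  by exists G; split=> // t; rewrite pG /r divff// scale1r.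
have clamp0 : clamp 0 = 0 by rewrite clamp_id//; exact: cube0.
elim: k => [_|k IH kN].
  exists (cst e0); split=> //; first exact: cst_continuous.
  by move=> t; rewrite /r mul0r scale0r.
have [G [Gc GA pG G0]] := IH (ltnW kN).
have loc t : exists s : (B -> E) * set B, [/\ open s.2,
    forall u, ball (r k *: clamp t) d u -> s.2 (f u) &
    local_section s.2 (G t) s.1].
  have [|b [U [oU Ub tU Us]]] := dP (r k *: clamp t).
    by apply: cubeZ (clamp_cube _); exact: r01 (ltnW kN).
  have [|s sP] := Us (G t) (GA t); last by exists (s, U).
  by rewrite pG; apply: tU; exact: ballxx.
have [s sP] := choice loc.
have rI (q : R) : `[r k, r k.+1]%classic q -> [/\ 0 <= q <= 1 & `|r k - q| <= N.+1%:R^-1].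
  rewrite /= in_itv/= => /andP[kq qk]; have := r01 _ kN; have := r01 _ (ltnW kN).
  move=> /andP[r0 _] /andP[_ r1]; split; first by rewrite (le_trans r0)//= (le_trans qk).
  by rewrite distrC ger0_norm ?subr_ge0// lerBlDl -rS.
(* The slack [d - N.+1%:R^-1] leaves room to move [t]: on nearby rays the whole next piece still
   maps into the open set evenly covered at [t]. *)
have near_seg t : \forall u \near t, forall q, `[r k, r k.+1]%classic q ->
    (s t).2 (f (q *: clamp u)).
  have : nbhs t (clamp @^-1` ball (clamp t) (d - N.+1%:R^-1)).
    by apply: clamp_continuous; apply: nbhsx_ballx; rewrite subr_gt0.
  apply: filterS => u [_ tu] q /rI[/andP[q0 q1] kq].
  have [_ ballP _] := sP t; apply: ballP; split=> // i j.
  have xy : `|clamp t 0 j - clamp u 0 j| < d - N.+1%:R^-1 by exact: tu.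
  have x01 := clamp_cube t j.
  suff : `|r k * clamp t 0 j - q * clamp u 0 j| < d.
    have ZE (a : R) (v : 'rV[R]_n) : (a *: v) 0 j = a * v 0 j by rewrite mxE.
    by rewrite (ord1 i) -!ZE.
  move: (clamp t 0 j) (clamp u 0 j) x01 xy => x y /andP[x0 x1] xy.
  rewrite (_ : _ - _ = (r k - q) * x + q * (x - y)); last by ring.
  apply: le_lt_trans (ler_normD _ _) _; rewrite !normrM (ger0_norm x0) (ger0_norm q0).
  have kqx : `|r k - q| * x <= N.+1%:R^-1 by apply: le_trans kq; rewrite ler_piMr.
  have qxy : q * `|x - y| <= `|x - y| by rewrite ler_piMl.
  apply: le_lt_trans (lerD kqx qxy) _; by rewrite -ltrBrDl.
have seg0 : `[r k, r k.+1]%classic (r k).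
  by rewrite /= in_itv/= lexx rS lerDl invr_ge0 ler0n.
have seg1 : `[r k, r k.+1]%classic (r k.+1).
  by rewrite /= in_itv/= lexx rS lerDl invr_ge0 ler0n.
(* The sections were chosen point by point. Those of [u] and of [t] both lift the next piece of the
   ray through [u], starting from [G u], so they agree at its end by uniqueness. *)
have glue t : \forall u \near t,
   (s u).1 (f (r k.+1 *: clamp u)) = (s t).1 (f (r k.+1 *: clamp u)).
  have [_ _ [_ _ sG]] := sP t.
  have sGt : \forall u \near t, A (G u) -> (s t).1 (p (G u)) = G u := Gc t _ sG.
  apply: filterS2 (near_seg t) sGt => u tu /(_ (GA u)) sGu.
  have uu := nbhs_singleton (near_seg u).
  have path_c v q : `[r k, r k.+1]%classic q -> (s v).2 (f (q *: clamp u)) ->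
      {for q, continuous (fun q : R^o => (s v).1 (f (q *: clamp u)))}.
    move=> qI vq; apply: (@continuous_comp _ _ _ (fun q : R^o => f (q *: clamp u))).
      apply: (@continuous_comp R^o _ _ (fun q : R^o => q *: clamp u)); last exact: fc.
      exact: scalel_continuous.
    by have [_ _ [/(_ _ vq)[]]] := sP v.
  apply: (@lift_unique R^o `[r k, r k.+1]%classic
    (fun q : R^o => (s u).1 (f (q *: clamp u)))
        (fun q : R^o => (s t).1 (f (q *: clamp u))) (r k)) => //.
  - exact: segment_connected.
  - move=> q qI; have [_ _ [/(_ _ (uu _ qI))[Aq pq _] _ _]] := sP u.
    split=> //; last exact: path_c (uu _ qI).
    by rewrite pq; apply: fO; apply: cubeZ (clamp_cube _); have [] := rI _ qI.
  - move=> q qI; have [_ _ [/(_ _ (tu _ qI))[Aq pq _] _ _]] := sP t.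
    have [_ _ [/(_ _ (uu _ qI))[_ puq _] _ _]] := sP u.
    by split=> //; [rewrite pq puq|exact: path_c (tu _ qI)].
  - by rewrite -pG sGu; have [_ _ [_ ->]] := sP u.
exists (fun t => (s t).1 (f (r k.+1 *: clamp t))); split=> [t|t|t|].
- pose h u := (s t).1 (f (r k.+1 *: clamp u)).
  suff hc : {for t, continuous h}.
    move=> V tV; have : nbhs t (h @^-1` V) := hc V tV.
    by apply: filterS2 (glue t) => u /= ->.
  apply: (@continuous_comp _ _ _ (fun u => f (r k.+1 *: clamp u))); last first.
    by have [_ _ [/(_ _ (nbhs_singleton (near_seg t) _ seg1))[]]] := sP t.
  apply: (@continuous_comp _ _ _ (fun u => r k.+1 *: clamp u)); last exact: fc.
  apply: (@continuous_comp _ _ _ clamp); first exact: clamp_continuous.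
  exact: scaler_continuous.
- by have [_ _ [/(_ _ (nbhs_singleton (near_seg t) _ seg1))[]]] := sP t.
- by have [_ _ [/(_ _ (nbhs_singleton (near_seg t) _ seg1))[]]] := sP t.
- have <- : (s 0).1 (p (G 0)) = e0 by have [_ _ [_ -> _]] := sP 0.
  by rewrite pG clamp0 !scaler0.
Qed.

End CubeLifting.
End Covering.

(** Segments inside a face project to [b], so uniqueness makes the lift constant on each face.
    Clearing a coordinate [j] other than [i] keeps a point in its face [i] and moves it to a face
    containing [0]; such a [j] exists because [1 < n]. *)
Lemma lift_boundary_const (R : realType) n (E B : topologicalType) (A : set E)
    (O : set B) (p : E -> B) (G : 'rV[R]_n -> E) (b : B) :
  hausdorff_space E -> covering A O p -> (1 < n)%N -> O b ->
  continuous G -> (forall t, A (G t)) ->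
  (forall t, cube R n t -> (exists i, t 0 i = 0 \/ t 0 i = 1) -> p (G t) = b) ->
  forall t, cube R n t -> (exists i, t 0 i = 0 \/ t 0 i = 1) -> G t = G 0.
Proof.
move=> E_hausdorff p_cov n1 Ob Gc GA pG.
have face t t' i : cube R n t -> cube R n t' -> t 0 i = t' 0 i ->
    t 0 i = 0 \/ t 0 i = 1 -> G t = G t'.
  move=> tP t'P tt' ti; pose g (q : R^o) := G ((1 - q) *: t + q *: t').
  have gc : continuous g.
    move=> q; apply: (@continuous_comp _ _ _ (fun q : R^o => (1 - q) *: t + q *: t')).
      apply: (@cvgD _ _ _ _ _ (fun q : R^o => (1 - q) *: t) (fun q => q *: t'));
        apply: cvgZr_tmp; last exact: cvg_id.
      by apply: cvgB; [exact: cvg_cst|exact: cvg_id].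
    exact: Gc.
  have pg q : `[0, 1]%classic q -> p (g q) = b.
    rewrite /= in_itv/= => /andP[q0 q1]; apply: pG => [j|].
      have /andP[a0 a1] := tP j; have /andP[b0 b1] := t'P j.
      by rewrite !mxE; apply/andP; split; nra.
    exists i; rewrite !mxE -tt'; move: ti.
    by rewrite -mulrDl subrK mul1r.
  have J0 : `[0, 1]%classic (0 : R) by rewrite /= in_itv/= lexx ler01.
  have J1 : `[0, 1]%classic (1 : R) by rewrite /= in_itv/= lexx ler01.
  have <- : g 0 = G t by rewrite /g subr0 scale1r scale0r addr0.
  have <- : g 1 = G t' by rewrite /g subrr scale0r scale1r add0r.
  apply/esym; apply: (lift_unique E_hausdorff p_cov (g := g) (h := cst (g 0))
    (@segment_connected R 0 1) _ _ J0) => // q qJ.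
    by split; [exact: GA|rewrite pg|exact: gc].
  by split; [exact: GA|rewrite /= !pg|exact: cst_continuous].
move=> t tP [i ti].
have [j ji] : exists j : 'I_n, j != i.
  case: n n1 i {Gc GA pG face G t tP ti} => [|[|n]]// _ i.
  by case: (eqVneq i ord0) => [->|i0]; [exists ord_max|exists ord0; rewrite eq_sym].
pose t' : 'rV[R]_n := \row_k (if k == j then 0 else t 0 k).
have t'P : cube R n t'.
  by move=> k; rewrite mxE; case: eqP => _; [rewrite lexx ler01|exact: tP].
rewrite (face t t' i)//; last by rewrite mxE eq_sym (negPf ji).
by apply: (face t' 0 j) => //; [exact: cube0|rewrite !mxE eqxx|left; rewrite mxE eqxx].
Qed.

(** * Ordered configurations *)

Lemma set_type_continuous_at (S T : topologicalType) (A : set T) (f : S -> A) x :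
  {for x, continuous (set_val \o f)} -> {for x, continuous f}.
Proof.
move=> fc V; rewrite nbhsE => -[_ [[W oW <-] Wfx] WV].
have : nbhs x ((set_val \o f) @^-1` W) by apply: fc; exact: open_nbhs_nbhs.
by apply: filterS => y Wy; exact: WV.
Qed.

Lemma injective_hausdorff (S T : topologicalType) (f : S -> T) :
  continuous f -> injective f -> hausdorff_space T -> hausdorff_space S.
Proof.
move=> fc f_inj hT x y xy; apply/f_inj/hT => V W fV fW.
have [z [Vz Wz]] := xy _ _ (fc x _ fV) (fc y _ fW).
by exists (f z).
Qed.

Section Configurations.
Variables (R : realType) (n : nat).
Local Notation ordered := (ordered_config R n).
Local Notation pic := (\pi_(config R n) : ordered -> config R n).

Lemma ordered_hausdorff : hausdorff_space ordered.
Proof.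
apply: (@injective_hausdorff _ _ (set_val : ordered -> _)).
- exact: initial_continuous.
- exact: val_inj.
- exact: norm_hausdorff.
Qed.

Lemma perm_config_subproof (s : 'S_n) (z : ordered) :
  col_perm s (set_val z) \in ordered_config R n.
Proof.
rewrite inE => i j; rewrite !mxE => zij.
by apply: (@perm_inj _ s); exact: (set_valP z) zij.
Qed.

Definition perm_config (s : 'S_n) (z : ordered) : ordered :=
  SigSub (perm_config_subproof s z).

Lemma perm_config_continuous s : continuous (perm_config s).
Proof.
move=> z; apply: set_type_continuous_at; apply: row_continuous_at => i.
rewrite (_ : (fun _ => _) = (fun v : 'rV__ => v 0 (s i)) \o set_val); last first.
  by apply/funext => w; rewrite /= mxE.
apply: continuous_comp; first exact: initial_continuous.
exact: row_coord_continuous.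
Qed.

Lemma perm_configM s t z : perm_config (s * t)%g z = perm_config s (perm_config t z).
Proof. by apply: val_inj; rewrite /= -col_permM. Qed.

Lemma perm_config1 z : perm_config 1 z = z.
Proof. by apply: val_inj; rewrite /= col_perm1. Qed.

Lemma perm_configK s z : perm_config s^-1 (perm_config s z) = z.
Proof. by rewrite -perm_configM mulVg perm_config1. Qed.

Lemma pi_config_eq z w : pic z = pic w <-> exists s, w = perm_config s z.
Proof.
split=> [/eqmodP/existsP[s /eqP zw]|[s ->]]; first by exists s; apply: val_inj.
by apply/eqmodP/existsP; exists s.
Qed.

Lemma perm_config_free s z : perm_config s z = z -> s = 1%g.
Proof.
move=> sz; apply/permP => i; rewrite perm1; apply: (set_valP z).
by have /(congr1 (fun v : ordered => set_val v 0 i)) := sz; rewrite mxE.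
Qed.

(** The saturation of an open set is the union of its preimages under the permutations. *)
Lemma pi_config_open (N : set ordered) : open N -> open (pic @` N).
Proof.
move=> oN; rewrite /open/= /quotient_open.
rewrite (_ : _ @^-1` _ = \bigcup_s perm_config s @^-1` N).
  apply: bigcup_open => s _; apply: open_comp oN => z _.
  exact: perm_config_continuous.
apply/seteqP; split=> [z [w Nw /esym/pi_config_eq[s ws]]|z [s _ Nz]].
  by exists s => //=; rewrite -ws.
by exists (perm_config s z) => //; apply/esym/pi_config_eq; exists s.
Qed.

(** A finite group acts freely on a Hausdorff space, so some neighbourhood [N] of [z] is disjoint
    from its translates. The projection is injective on [N], and the sheets are the translates of
    [N]. *)
Lemma config_covering : covering setT setT pic.
Proof.
move=> b _; pose z := repr b.
have [N [oN Nz NP]] : exists N : set ordered, [/\ open N, N z &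
    forall s x, N x -> N (perm_config s x) -> s = 1%g].
  have sep s : exists W : set ordered, nbhs z W /\
      (s != 1%g -> forall x, W x -> ~ W (perm_config s x)).
    have [->|s1] := eqVneq s 1%g; first by exists setT; split=> //; exact: filterT.
    have : ~ cluster (nbhs (perm_config s z)) z.
      by move=> /ordered_hausdorff/perm_config_free; exact/eqP.
    move=> /existsNP[P /existsNP[Q /not_implyP[sP /not_implyP[zQ PQ]]]].
    exists (perm_config s @^-1` P `&` Q); split.
      by apply: filterI => //; exact: perm_config_continuous.
    by move=> _ x [/= Px _] [_ Qx]; apply: PQ; exists (perm_config s x).
  have [W WP] := choice sep.
  exists (interior [set x | forall s, W s x]); split.
  - exact: open_interior.
  - suff : \forall x \near z, forall s, W s x by [].
    exact: (@filter_forall _ {perm 'I_n} W (nbhs z) _ (fun s => (WP s).1)).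
  - move=> s x /nbhs_singleton Wx /nbhs_singleton Wsx; apply: contrapT => /eqP s1.
    by have [_ /(_ s1 x (Wx s))] := WP s; apply.
(* The inverse of the projection on [N], with default value [z] elsewhere. *)
pose inv c := xget z [set x | N x /\ pic x = c].
have invP c : (pic @` N) c -> N (inv c) /\ pic (inv c) = c.
  move=> [x Nx xc]; suff : [set x | N x /\ pic x = c] (inv c) by [].
  by apply: xgetPex; exists x.
have invK x : N x -> inv (pic x) = x.
  move=> Nx; have [|Ni /esym/pi_config_eq[s is_]] := invP (pic x); first by exists x.
  by have := NP s x Nx; rewrite -is_ => /(_ Ni) s1; rewrite is_ s1 perm_config1.
exists (pic @` N).
  by split; [exact: pi_config_open|exists z => //; rewrite reprK].
move=> e _ [z' Nz' /esym/pi_config_eq[t z'e]].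
(* [perm_config t] carries [e] to the point [z'] of [N], so the sheet through [e] is [N] moved back
   by [t]. *)
exists (fun c => perm_config t^-1 (inv c)); split.
- move=> c Uc; have [Ni ic] := invP c Uc; split=> //.
    by rewrite -[RHS]ic; apply/esym/pi_config_eq; exists t^-1%g.
  move=> V /= cV.
  have : nbhs (inv c) (N `&` perm_config t^-1 @^-1` V).
    apply: filterI; first exact: open_nbhs_nbhs.
    exact: perm_config_continuous.
  rewrite nbhsE => -[W [oW Wi] WV].
  have : nbhs c (pic @` W).
    by apply: open_nbhs_nbhs; split; [exact: pi_config_open|exists (inv c)].
  by apply: filterS => _ [x /WV[Nx Vx] <-] /=; rewrite invK.
- have -> : pic e = pic z' by apply/pi_config_eq; exists t.
  by rewrite invK// z'e perm_configK.
- have : nbhs e (perm_config t @^-1` N).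
    by apply: perm_config_continuous; apply: open_nbhs_nbhs; split=> //; rewrite -z'e.
  apply: filterS => x /= Nx _.
  have -> : pic x = pic (perm_config t x) by apply/pi_config_eq; exists t.
  by rewrite invK// perm_configK.
Qed.

End Configurations.

(** * Linear reflection groups *)

Section ReflectionGroup.
Variables (R : realType) (V : normedModType R) (I : finType).
Variables (ell : I -> V -> R) (nrm : I -> V).
Hypothesis ell_lin : forall i a u v, ell i (a *: u + v) = a * ell i u + ell i v.
Hypothesis ell_continuous : forall i, continuous (ell i).
Hypothesis ell_nrm : forall i, ell i (nrm i) = 2.
(** Vinberg's inequality for walls that do not cross inside the cone: it makes the product of two
    different reflections an element of infinite order. *)
Hypothesis ell_nrm_le : forall i j, i != j -> ell j (nrm i) <= - 2.

Let ell0 i : ell i 0 = 0.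
Proof. by have := ell_lin i (-1) 0 0; rewrite scaler0 addr0 mulN1r addNr. Qed.

Let ellZ i a u : ell i (a *: u) = a * ell i u.
Proof. by have := ell_lin i a u 0; rewrite addr0 ell0 addr0. Qed.

Let ellD i u v : ell i (u + v) = ell i u + ell i v.
Proof. by have := ell_lin i 1 u v; rewrite scale1r mul1r. Qed.

Definition refl i (v : V) := v - ell i v *: nrm i.

Lemma ell_refl i j v : ell j (refl i v) = ell j v - ell i v * ell j (nrm i).
Proof. by rewrite /refl -scaleNr ellD ellZ mulNr. Qed.

Lemma ell_refl_id i v : ell i (refl i v) = - ell i v.
Proof. by rewrite ell_refl ell_nrm; ring. Qed.

Lemma reflK i : involutive (refl i).
Proof. by move=> v; rewrite {1}/refl ell_refl_id scaleNr opprK subrK. Qed.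

Lemma refl_wall i v : ell i v = 0 -> refl i v = v.
Proof. by move=> v0; rewrite /refl v0 scale0r subr0. Qed.

Lemma refl_lin i a u v : refl i (a *: u + v) = a *: refl i u + refl i v.
Proof. by rewrite /refl ell_lin scalerDl scalerBr scalerA opprD addrACA. Qed.

Lemma refl_continuous i : continuous (refl i).
Proof.
move=> v; apply: cvgB; first exact: cvg_id.
by apply: cvgZr_tmp; exact: ell_continuous.
Qed.

Definition act (w : seq I) (v : V) := foldr refl v w.

Arguments act : simpl never.

Lemma act_cons i w v : act (i :: w) v = refl i (act w v).
Proof. by []. Qed.

Lemma act_cat w1 w2 v : act (w1 ++ w2) v = act w1 (act w2 v).
Proof. by rewrite /act foldr_cat. Qed.

Lemma act_revK w v : act (rev w) (act w v) = v.
Proof. by elim: w v => //= i w IH v; rewrite rev_cons -cats1 act_cat !act_cons reflK. Qed.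

Lemma act_lin w a u v : act w (a *: u + v) = a *: act w u + act w v.
Proof. by elim: w => //= i w; rewrite !act_cons => ->; rewrite refl_lin. Qed.

Lemma actZ w a u : act w (a *: u) = a *: act w u.
Proof.
have act0 : act w 0 = 0.
  by have := act_lin w (-1) 0 0; rewrite scaler0 addr0 scaleN1r addNr.
by rewrite -[a *: u]addr0 act_lin act0 addr0.
Qed.

Lemma act_continuous w : continuous (act w).
Proof.
elim: w => [|i w IH] v; first exact: cvg_id.
by apply: (@continuous_comp _ _ _ (act w)); [exact: IH|exact: refl_continuous].
Qed.

Definition reduced (w : seq I) : bool := sorted (fun i j => i != j) w.

(** Equal neighbours cancel in pairs, so the parity of the length survives; it will decide which of
    the two hexagons a tile covers. *)
Lemma reduced_cons i w : reduced (i :: w) -> reduced w.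
Proof. by case: w => //= j w /andP[]. Qed.

Lemma reduce w : exists w', [/\ reduced w', act w' =1 act w &
  odd (size w') = odd (size w)].
Proof.
elim: w => [|i w [w' [red_w' w'E w'odd]]]; first by exists [::].
case: w' red_w' w'E w'odd => [|j w'] red_w' w'E w'odd.
  by exists [:: i]; split=> [|v|] //=; [rewrite !act_cons -w'E|rewrite -w'odd].
have [ij|ij] := eqVneq i j.
  exists w'; split; first exact: reduced_cons red_w'.
    by move=> v; rewrite act_cons -w'E act_cons ij reflK.
  by rewrite /= -w'odd /= negbK.
exists [:: i, j & w']; split=> [|v|].
- by rewrite /= ij.
- by rewrite [RHS]act_cons -w'E.
- by rewrite /= -w'odd.
Qed.

(* The fundamental chamber without its faces of codimension two. *)
Definition chamber : set V := [set v | (forall i, 0 <= ell i v) /\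
  forall i j, i != j -> 0 < ell i v + ell j v].

Lemma ping_pong i w d : reduced (i :: w) -> chamber d ->
  ell i (act (i :: w) d) <= 0 /\
  forall j, i != j -> 0 <= ell i (act (i :: w) d) + ell j (act (i :: w) d).
Proof.
move=> red_w [d0 dD]; elim: w i red_w => [|k w IH] i red_w.
  split; first by rewrite act_cons ell_refl_id oppr_le0.
  move=> j ij; rewrite act_cons ell_refl_id ell_refl.
  by have := ell_nrm_le ij; have := d0 i; have := d0 j; nra.
have /andP[ik red_kw] := red_w.
have [uk uD] := IH k red_kw.
rewrite act_cons; move: (act (k :: w) d) uk uD => u uk uD.
have u0 j : k != j -> 0 <= ell j u by move=> /uD; lra.
have ui : 0 <= ell i u by apply: u0; rewrite eq_sym.
split; first by rewrite ell_refl_id oppr_le0.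
move=> j ij; have uij : 0 <= ell i u + ell j u.
  have [<-|kj] := eqVneq k j; first by rewrite addrC uD// eq_sym.
  by rewrite addr_ge0// u0.
by rewrite ell_refl_id ell_refl; have := ell_nrm_le ij; nra.
Qed.

Lemma chamber_unique w d : chamber d -> chamber (act w d) ->
  act w d = d /\ (odd (size w) -> exists i, ell i d = 0).
Proof.
move=> dP; have [w' [red_w' w'E <-]] := reduce w; rewrite -w'E {w w'E}.
elim: w' red_w' => [//|i w IH] red_w xP.
have [xi _] := ping_pong red_w dP.
have {}xi : ell i (act (i :: w) d) = 0.
  by apply/eqP; rewrite eq_le xi; case: xP => ->.
have xE : act (i :: w) d = act w d by rewrite -[LHS](refl_wall xi) act_cons reflK.
rewrite xE in xP xi *; have [wd _] := IH (reduced_cons red_w) xP.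
by rewrite wd in xi *; split=> // _; exists i.
Qed.

Definition tits_cone : set V := [set v | exists w, chamber (act w v)].

Lemma tits_coneP v : tits_cone v -> exists w d, chamber d /\ v = act w d.
Proof. by move=> [w wv]; exists (rev w), (act w v); rewrite act_revK. Qed.

Lemma act_tits_cone w v : tits_cone (act w v) <-> tits_cone v.
Proof.
split=> -[w' wv]; first by exists (w' ++ w); rewrite act_cat.
by exists (w' ++ rev w); rewrite act_cat act_revK.
Qed.

(** Induction on the reduced word, for all [y] of the chamber at once: the segment can leave the
    chamber only through the wall of the first letter, and reflecting its remainder there shortens
    the word. *)
Lemma tits_cone_star y w d (q : R) : chamber y -> chamber d -> 0 <= q <= 1 ->
  tits_cone (q *: act w d + (1 - q) *: y).
Proof.
move=> yP dP; have [w' [red_w' w'E _]] := reduce w; rewrite -w'E {w w'E}.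
elim: w' red_w' y yP q => [|i w IH] red_w y yP q /andP[q0 q1].
  exists [::]; case: yP => y0 yD; case: dP => d0 dD; split=> [j|j k jk] /=.
    by rewrite ell_lin ellZ addr_ge0// mulr_ge0// subr_ge0.
  rewrite !ell_lin !ellZ addrACA -!mulrDr.
  have := yD _ _ jk; have := dD _ _ jk.
  move: (_ + _) (_ + _) => a b a0 b0.
  have [->|qN0] := eqVneq q 0; first by rewrite mul0r add0r subr0 mul1r.
  by rewrite ltr_wpDr ?mulr_ge0 ?subr_ge0 ?(ltW b0)// mulr_gt0// lt_neqAle eq_sym qN0.
have [xi xD] := ping_pong red_w dP.
set x := act (i :: w) d in xi xD *.
have [->|qN1] := eqVneq q 1.
  by rewrite scale1r subrr scale0r addr0; apply/act_tits_cone; exists [::].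
have {qN1 q1} q1 : q < 1 by rewrite lt_neqAle qN1.
have x0 j : i != j -> 0 <= ell j x by move=> /xD; lra.
(* By ping-pong only the form of the letter [i] can be negative at [x], so no other wall can be
   crossed before the end. *)
have inside (r : R) : 0 <= r < 1 -> 0 <= ell i (r *: x + (1 - r) *: y) ->
    chamber (r *: x + (1 - r) *: y).
  move=> /andP[r0 r1] zi; case: yP => y0 yD.
  have xD' j k : j != k -> 0 <= ell j x + ell k x.
    move=> jk; have [ij|ij] := eqVneq i j; first by rewrite -ij in jk *; exact: xD.
    have [ik|ik] := eqVneq i k.
      by rewrite addrC -ik xD// ik eq_sym.
    by rewrite addr_ge0// x0.
  split=> [j|j k jk].
    have [<-|ij] := eqVneq i j; first exact: zi.
    by rewrite ell_lin ellZ addr_ge0// mulr_ge0// ?x0// subr_ge0 ltW.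
  rewrite !ell_lin !ellZ addrACA -!mulrDr ltr_wpDl ?mulr_ge0 ?xD'//.
  by rewrite mulr_gt0 ?subr_gt0 ?yD.
have [zi|zi] := leP 0 (ell i (q *: x + (1 - q) *: y)).
  by exists [::]; apply: inside => //; rewrite q0.
have yi : 0 <= ell i y by case: yP => y0 _; exact: y0.
have xi0 : ell i x < 0 by move: zi; rewrite ell_lin ellZ; nra.
(* [r] is where the segment from [y] to [x] meets the wall [i]; beyond it the
   reflected segment ends at the shorter [act w d]. *)
pose r := ell i y / (ell i y - ell i x).
have den : 0 < ell i y - ell i x by lra.
have r0 : 0 <= r by rewrite divr_ge0// ltW.
have r1 : r < 1 by rewrite ltr_pdivrMr// mul1r; lra.
have rE : r * (ell i y - ell i x) = ell i y by rewrite divfK// gt_eqF.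
have zr : ell i (r *: x + (1 - r) *: y) = 0 by rewrite ell_lin ellZ; lra.
have y'P := inside r; rewrite zr r0 r1 lexx in y'P.
have {}y'P := y'P isT isT.
have rq : r <= q by move: zi; rewrite ell_lin ellZ; nra.
(* The parameter, on the segment from the crossing point to [x], of the point with parameter [q]. *)
pose q' := (q - r) / (1 - r).
have q'E : q' * (1 - r) = q - r by rewrite divfK// gt_eqF// subr_gt0.
have q'01 : 0 <= q' <= 1.
  by rewrite divr_ge0 ?subr_ge0 ?(ltW r1)//= ler_pdivrMr ?subr_gt0//; lra.
set y' := r *: x + (1 - r) *: y in zr y'P.
have zE : q *: x + (1 - q) *: y = q' *: x + (1 - q') *: y'.
  rewrite /y'; move: (x) (y) => a b; rewrite scalerDr !scalerA addrA -scalerDl;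
      congr (_ *: _ + _ *: _); lra.
apply/(act_tits_cone [:: i]).
suff -> : act [:: i] (q *: x + (1 - q) *: y) = q' *: act w d + (1 - q') *: y'.
  exact: IH (reduced_cons red_w) _ y'P q' q'01.
by rewrite zE act_cons refl_lin /x act_cons reflK refl_wall// ellZ zr mulr0.
Qed.

(** The group acts linearly, so one end of the segment may be moved into the chamber. *)
Lemma tits_cone_convex u v (q : R) : tits_cone u -> tits_cone v ->
  0 <= q <= 1 -> tits_cone (q *: u + (1 - q) *: v).
Proof.
move=> uE /tits_coneP[w [y [yP ->]]] q01.
apply/(act_tits_cone (rev w)); rewrite act_lin actZ act_revK.
have /tits_coneP[w' [d [dP ->]]] : tits_cone (act (rev w) u) by apply/act_tits_cone.
exact: tits_cone_star.
Qed.

(** A point of the chamber lies on at most one wall, as two forms never vanish together. So only the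
    chamber and its mirror image in that wall come close to it. *)
Lemma near_chamber d : chamber d -> \forall d' \near d, chamber d' \/
  exists i, [/\ ell i d = 0, ell i d' <= 0 & chamber (refl i d')].
Proof.
move=> [d0 dD].
have [[i di]|dN] := pselect (exists i, ell i d = 0); last first.
  have dpos i : 0 < ell i d.
    by rewrite lt_neqAle d0 andbT; apply/eqP => di; apply: dN; exists i.
  have : \forall d' \near d, forall i, 0 < ell i d'.
    by apply: filter_forall => i; apply: near_gt0 => //; exact: ell_continuous.
  apply: filterS => d' d'0; left; split=> [i|i j _]; first exact: ltW.
  by rewrite addr_gt0.
have : \forall d' \near d, forall j, i != j -> 0 < ell j d' /\ 0 < ell j (refl i d').
  apply: filter_forall => j; have [<-|ij] := eqVneq i j; first exact: nearW.
  have dj : 0 < ell j d by have := dD i j ij; rewrite di add0r.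
  have d1 := near_gt0 (@ell_continuous j d) dj.
  have d2 : \forall d' \near d, 0 < ell j (refl i d').
    apply: near_gt0; last by rewrite refl_wall.
    by apply: (@continuous_comp _ _ _ (refl i));
        [exact: refl_continuous|exact: ell_continuous].
  by apply: filterS2 d1 d2.
apply: filterS => d' d'P.
have in_chamber u : 0 <= ell i u -> (forall j, i != j -> 0 < ell j u) -> chamber u.
  move=> ui uj; split=> [j|j k jk].
    by have [<-//|ij] := eqVneq i j; exact/ltW/uj.
  have [ij|ij] := eqVneq i j; first by rewrite -ij in jk *; rewrite ltr_wpDl// uj.
  rewrite ltr_wpDr ?uj//; have [<-//|ik] := eqVneq i k; exact/ltW/uj.
have [d'i|d'i] := leP 0 (ell i d').
  by left; apply: in_chamber => // j /d'P[].
right; exists i; split=> //; first exact: ltW.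
apply: in_chamber => [|j /d'P[]//].
by rewrite ell_refl_id oppr_ge0 ltW.
Qed.

Lemma near_tits_cone v : tits_cone v -> \forall u \near v, tits_cone u.
Proof.
move=> [w wv].
have near_w : \forall u \near v, chamber (act w u) \/ exists i,
    [/\ ell i (act w v) = 0, ell i (act w u) <= 0 & chamber (refl i (act w u))].
  exact: act_continuous (near_chamber wv).
by apply: filterS near_w => u [uP|[i [_ _ uP]]]; [exists w|exists (i :: w)].
Qed.

Definition word_of v := xget [::] [set w | chamber (act w v)].

Definition folded v := act (word_of v) v.

Lemma folded_chamber v : tits_cone v -> chamber (folded v).
Proof.
move=> [w wv]; suff : [set w | chamber (act w v)] (word_of v) by [].
by apply: xgetPex; exists w.
Qed.

(** Two words folding [v] into the chamber differ by a word to which [chamber_unique] applies: the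
    folded point is well defined, and the parity is ambiguous only on walls. *)
Lemma foldedP w v : chamber (act w v) -> folded v = act w v /\
  (odd (size w) != odd (size (word_of v)) -> exists i, ell i (act w v) = 0).
Proof.
move=> wv; have vP := folded_chamber (ex_intro _ w wv).
have := @chamber_unique (word_of v ++ rev w) _ wv.
rewrite act_cat act_revK => /(_ vP)[wvE wall]; split=> // odd_w.
apply: wall; rewrite size_cat size_rev oddD; move: odd_w.
by case: odd; case: odd.
Qed.

(** * Gluing functions across the walls of the tiling *)

Section Unfold.
Variables (T : topologicalType) (f : bool -> V -> T).
Hypothesis f_continuous : forall b v, chamber v -> {for v, continuous (f b)}.
Hypothesis f_wall : forall i v, chamber v -> ell i v = 0 -> f true v = f false v.

(* [f false] on even tiles and [f true] on odd ones. *)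
Definition unfold v := f (odd (size (word_of v))) (folded v).

Lemma unfoldE w v : chamber (act w v) -> unfold v = f (odd (size w)) (act w v).
Proof.
move=> wv; rewrite /unfold; have [-> wall] := foldedP wv.
have [->//|/wall[i wi]] := eqVneq (odd (size w)) (odd (size (word_of v))).
by case: odd; case: odd => //; rewrite (f_wall wv wi).
Qed.

(** Near [v] only its tile and possibly the neighbour across one wall occur. Each carries a
    continuous function, and [f_wall] makes the two agree on the wall. *)
Lemma unfold_continuous v : tits_cone v -> {for v, continuous unfold}.
Proof.
move=> [w wv] W; rewrite (unfoldE wv) => Wv.
have act_near (P : set V) : nbhs (act w v) P -> \forall u \near v, P (act w u).
  exact: act_continuous.
have even_near := act_near _ (f_continuous wv Wv).
have odd_near : \forall u \near v, forall i, ell i (act w v) = 0 ->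
    W (f (~~ odd (size w)) (refl i (act w u))).
  apply: filter_forall => i.
  have [wi|wi] := pselect (ell i (act w v) = 0); last by apply: nearW => u /wi.
  have {}Wv : nbhs (f (~~ odd (size w)) (act w v)) W.
    by move: Wv; case: odd; rewrite (f_wall wv wi).
  have := f_continuous wv Wv; rewrite -{1}(refl_wall wi) => /refl_continuous.
  by move=> /act_near; apply: filterS => u.
apply: filterS3 even_near odd_near (act_near _ (near_chamber wv)).
move=> u even_u odd_u [uP|[i [wi _ uP]]]; rewrite /= ?(unfoldE uP)//.
by rewrite (@unfoldE (i :: w)) //=; exact: odd_u.
Qed.

End Unfold.

End ReflectionGroup.

(** * The punctured plane as two ideal hexagons *)

Section EllipticCoordinates.
Variable R : realType.
Implicit Types (z : R * R).

(** The semi-major axis of the ellipse with foci [-1] and [1] through [z]; [focal_diff] is the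
    signed semi-axis of the confocal hyperbola. *)
Definition focal_sum z : R :=
  (Num.sqrt ((z.1 + 1) ^+ 2 + z.2 ^+ 2) + Num.sqrt ((z.1 - 1) ^+ 2 + z.2 ^+ 2)) / 2.
Definition focal_diff z : R :=
  (Num.sqrt ((z.1 + 1) ^+ 2 + z.2 ^+ 2) - Num.sqrt ((z.1 - 1) ^+ 2 + z.2 ^+ 2)) / 2.

Lemma focal_fst z : focal_sum z * focal_diff z = z.1.
Proof.
rewrite /focal_sum /focal_diff.
have := @sqr_sqrtr R ((z.1 + 1) ^+ 2 + z.2 ^+ 2); rewrite addr_ge0 ?sqr_ge0// => /(_ isT).
have := @sqr_sqrtr R ((z.1 - 1) ^+ 2 + z.2 ^+ 2); rewrite addr_ge0 ?sqr_ge0// => /(_ isT).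
by move: (Num.sqrt _) (Num.sqrt _) => s t; nra.
Qed.

Lemma focal_snd z :
  (focal_sum z ^+ 2 - 1) * (1 - focal_diff z ^+ 2) = z.2 ^+ 2.
Proof.
have -> : (focal_sum z ^+ 2 - 1) * (1 - focal_diff z ^+ 2) =
   focal_sum z ^+ 2 + focal_diff z ^+ 2 - 1 - (focal_sum z * focal_diff z) ^+ 2 by ring.
rewrite focal_fst /focal_sum /focal_diff.
have := @sqr_sqrtr R ((z.1 + 1) ^+ 2 + z.2 ^+ 2); rewrite addr_ge0 ?sqr_ge0// => /(_ isT).
have := @sqr_sqrtr R ((z.1 - 1) ^+ 2 + z.2 ^+ 2); rewrite addr_ge0 ?sqr_ge0// => /(_ isT).
by move: (Num.sqrt _) (Num.sqrt _) => s t; nra.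
Qed.

(** The product in [focal_snd] is nonnegative, so its factors cannot have opposite signs; with the
    absolute value of [focal_diff] at most [focal_sum], this puts 1 between them. *)
Lemma focal_bounds z : 1 <= focal_sum z /\ -1 <= focal_diff z <= 1.
Proof.
have := sqr_ge0 z.2; rewrite -focal_snd.
have le_ds : `|focal_diff z| <= focal_sum z.
  rewrite /focal_sum /focal_diff; move: (sqrtr_ge0 ((z.1 + 1) ^+ 2 + z.2 ^+ 2)).
  move: (sqrtr_ge0 ((z.1 - 1) ^+ 2 + z.2 ^+ 2)); move: (Num.sqrt _) (Num.sqrt _) => s t s0 t0.
  by rewrite ler_norml; apply/andP; split; lra.
rewrite -(@real_normK _ (focal_diff z)) ?num_real// => p0.
have := normr_ge0 (focal_diff z); rewrite -ler_norml.
move: (`|_|) (focal_sum z) le_ds p0 => d s le_ds p0 d0.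
have s1 : 1 <= s.
  rewrite leNgt; apply/negP => s1; move: p0; apply/negP; rewrite -ltNge.
  by rewrite nmulr_rlt0 ?subr_lt0 ?subr_gt0 ?expr_lt1//; lra.
split=> //; rewrite leNgt; apply/negP => d1; move: p0; apply/negP; rewrite -ltNge.
by rewrite pmulr_rlt0 ?subr_lt0 ?subr_gt0 ?exprn_egt1//; lra.
Qed.

(** The distances to the foci come out as [b + d] and [b - d], both nonnegative by the bounds. *)
Lemma focal_coords (b d : R) z : 1 <= b -> -1 <= d <= 1 -> z.1 = b * d ->
  z.2 ^+ 2 = (b ^+ 2 - 1) * (1 - d ^+ 2) -> focal_sum z = b /\ focal_diff z = d.
Proof.
move=> b1 /andP[d1 d1'] z1 z2; rewrite /focal_sum /focal_diff z2 z1.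
have -> : (b * d + 1) ^+ 2 + (b ^+ 2 - 1) * (1 - d ^+ 2) = (b + d) ^+ 2 by ring.
have -> : (b * d - 1) ^+ 2 + (b ^+ 2 - 1) * (1 - d ^+ 2) = (b - d) ^+ 2 by ring.
by rewrite !sqrtr_sqr !ger0_norm; [split; lra|lra|lra].
Qed.

Lemma focal_continuous : continuous focal_sum /\ continuous focal_diff.
Proof.
have sc (c : R) : continuous (fun z => Num.sqrt ((z.1 + c) ^+ 2 + z.2 ^+ 2)).
  move=> z; apply: (@continuous_comp _ _ _ (fun z => (z.1 + c) ^+ 2 + z.2 ^+ 2)).
    apply: cvgD.
      apply: (@continuous_comp _ _ _ (fun z : R * R => z.1 + c) (fun x : R => x ^+ 2)).
        by apply: cvgD; [exact: cvg_fst|exact: cvg_cst].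
      exact: exprn_continuous.
    apply: (@continuous_comp _ _ _ (fun z : R * R => z.2) (fun x : R => x ^+ 2));
        first exact: cvg_snd.
    exact: exprn_continuous.
  exact: sqrt_continuous.
by split=> z; apply: cvgM; try exact: cvg_cst; [apply: cvgD|apply: cvgB]; exact: sc.
Qed.

End EllipticCoordinates.

(** * The hexagon in projective coordinates *)

Section Hexagon.
Variable R : realType.
Local Notation V := (R^o * R^o * R^o)%type.
Implicit Types (v : V) (z : R * R) (i j : 'I_6).

(* The sides of the ideal hexagon with vertices [-1], [-1/3], [0], [1/3], [1]
   on the conic [y = x ^ 2] and the point at infinity of its axis, in
   homogeneous coordinates [(x, y, h)]. *)
Definition side i v : R :=
  match val i with
  | 0 => 2 * v.1.1 + 2 * v.2
  | 1 => 4 * v.1.1 + 3 * v.1.2 + v.2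
  | 2 => 2 * v.1.1 + 6 * v.1.2
  | 3 => - 2 * v.1.1 + 6 * v.1.2
  | 4 => - 4 * v.1.1 + 3 * v.1.2 + v.2
  | _ => - 2 * v.1.1 + 2 * v.2
  end.

(* The polar of each side with respect to the conic. *)
Definition pole i : V :=
  match val i with
  | 0 => (1, - 2, 0)
  | 1 => (2, - 1, - 3)
  | 2 => (1, 0, - 6)
  | 3 => (- 1, 0, - 6)
  | 4 => (- 2, - 1, - 3)
  | _ => (- 1, - 2, 0)
  end.

Lemma side_lin i a u v : side i (a *: u + v) = a * side i u + side i v.
Proof.
by case: i => -[|[|[|[|[|[|]]]]]] //= ?; rewrite /side /= /GRing.scale /=; ring.
Qed.

Lemma sideZ i a v : side i (a *: v) = a * side i v.
Proof.
have side0 : side i 0 = 0.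
  by have := side_lin i (-1) 0 0; rewrite scaler0 addr0 mulN1r addNr.
by rewrite -[a *: v]addr0 side_lin side0 addr0.
Qed.

Lemma side_continuous i : continuous (side i).
Proof.
have lc (a b c : R) : continuous (fun v => a * v.1.1 + b * v.1.2 + c * v.2).
  move=> v; have v1 : {for v, continuous (fun v : V => v.1)} by exact: cvg_fst.
  apply: cvgD; first apply: cvgD; (apply: cvgM; first exact: cvg_cst).
  - by apply: (@continuous_comp _ _ _ (fun v : V => v.1) (fun u : R^o * R^o => u.1));
      [exact: cvg_fst|exact: cvg_fst].
  - by apply: (@continuous_comp _ _ _ (fun v : V => v.1) (fun u : R^o * R^o => u.2));
      [exact: cvg_fst|exact: cvg_snd].
  - exact: cvg_snd.
suff [a [b [c ->]]] : exists a b c,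
    side i = fun v => a * v.1.1 + b * v.1.2 + c * v.2 by exact: lc.
by case: i => -[|[|[|[|[|[|]]]]]] //= ?; rewrite /side /=;
  [exists 2, 0, 2|exists 4, 3, 1|exists 2, 6, 0|exists (-2), 6, 0|
   exists (-4), 3, 1|exists (-2), 0, 2]; apply/funext => v; ring.
Qed.

Lemma side_pole i : side i (pole i) = 2.
Proof. by case: i => -[|[|[|[|[|[|]]]]]] //= ?; rewrite /side /=; ring. Qed.

(** The value is exactly [- 2] for adjacent sides, which meet at an ideal vertex, and smaller for
    the others. *)
Lemma side_pole_le i j : i != j -> side j (pole i) <= - 2.
Proof.
by case: i => -[|[|[|[|[|[|]]]]]] //= ?; case: j => -[|[|[|[|[|[|]]]]]] //= ? _;
  rewrite /side /=; lra.
Qed.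

Local Notation hexagon := (chamber side).

(* The lower boundary of the hexagon [h = 1]. *)
Definition lower (x : R) : R :=
  Num.max (Num.max (- (4 * x + 1) / 3) (- x / 3)) (Num.max (x / 3) ((4 * x - 1) / 3)).

(** The height above the lower boundary is [focal_sum z - 1]. The segment between the foci is thus
    bent onto the four lower sides, the half-lines beyond the foci go to the two vertical sides, and
    the punctures to the finite vertices. Conjugate points have the same image. *)
Definition to_hexagon z : V :=
  (focal_diff z, focal_sum z - 1 + lower (focal_diff z), 1).

(** Homogeneous of degree 0 in [v]. The coordinate [y] is recovered through [focal_snd] up to sign,
    and [b] chooses the lower half plane. *)
Definition from_hexagon (b : bool) v : R * R :=
  let d := v.1.1 / v.2 in let s := 1 + v.1.2 / v.2 - lower d in
  let y := Num.sqrt ((s ^+ 2 - 1) * (1 - d ^+ 2)) in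
  (s * d, if b then - y else y).

Definition puncture z : Prop := z.2 = 0 /\
  [\/ z.1 = 0, z.1 = 1 / 3 \/ z.1 = - (1 / 3) | z.1 = 1 \/ z.1 = -1].

Lemma lower_ge x : [/\ - (4 * x + 1) / 3 <= lower x, - x / 3 <= lower x,
  x / 3 <= lower x & (4 * x - 1) / 3 <= lower x].
Proof. by rewrite /lower !le_max !lexx !orbT. Qed.

Lemma lowerP x : [\/ lower x = - (4 * x + 1) / 3 \/ lower x = - x / 3,
  lower x = x / 3 | lower x = (4 * x - 1) / 3].
Proof.
rewrite /lower; have [_|_] := leP (Num.max _ _) (Num.max _ _).
  by have [_|_] := leP (x / 3) _; [apply: Or33|apply: Or32].
by apply: Or31; have [_|_] := leP (- (4 * x + 1) / 3) _; [right|left].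
Qed.

Lemma hexagon_height v : hexagon v -> 0 < v.2.
Proof.
move=> [_ /(_ (@Ordinal 6 0 isT) (@Ordinal 6 5 isT) isT)].
by rewrite /side /=; lra.
Qed.

Lemma side_to_hexagon_ge0 i z : 0 <= side i (to_hexagon z).
Proof.
have [s1 /andP[d0 d1]] := focal_bounds z.
have [l1 l2 l3 l4] := lower_ge (focal_diff z).
by case: i => -[|[|[|[|[|[|]]]]]] //= ?; rewrite /side /=; lra.
Qed.

(** At height 1 two sides vanish together only at a finite vertex, and such a vertex comes only from
    a puncture. *)
Lemma to_hexagonP z : ~ puncture z -> hexagon (to_hexagon z).
Proof.
move=> zP; have [s1 /andP[d0 d1]] := focal_bounds z.
have [l1 l2 l3 l4] := lower_ge (focal_diff z).
have zN : ~ (focal_sum z = 1 /\ [\/ focal_diff z = 0,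
    focal_diff z = 1 / 3 \/ focal_diff z = - (1 / 3) |
    focal_diff z = 1 \/ focal_diff z = -1]).
  move=> [s d]; apply: zP; split; last by rewrite -focal_fst s mul1r.
  by apply/eqP; rewrite -sqrf_eq0 -focal_snd s; apply/eqP; ring.
have pos i := side_to_hexagon_ge0 i z.
split=> // i j ij; rewrite lt_neqAle addr_ge0// andbT; apply/eqP => ij0.
have i0 : side i (to_hexagon z) = 0 by have := pos i; have := pos j; lra.
have j0 : side j (to_hexagon z) = 0 by lra.
apply: zN; move: ij i0 j0 {ij0 pos}; rewrite /side /=.
move: (focal_sum z) (focal_diff z) (lower _) s1 d0 d1 l1 l2 l3 l4 => s d l.
move=> s1 d0 d1 l1 l2 l3 l4.
case: i => -[|[|[|[|[|[|]]]]]] //= ?; case: j => -[|[|[|[|[|[|]]]]]] //= ? _ i0 j0;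
 first [exfalso; lra | split; [lra|]];
 first [by apply: Or31; lra|by apply: Or32; left; lra|by apply: Or32; right; lra|
   by apply: Or33; left; lra|by apply: Or33; right; lra].
Qed.

End Hexagon.

Section HexagonCovering.
Variable R : realType.
Local Notation V := (R^o * R^o * R^o)%type.
Implicit Types (v : V) (z : R * R) (i j : 'I_6).
Local Notation side := (@side R).
Local Notation pole := (@pole R).
Local Notation hexagon := (chamber side).
Local Notation refl := (refl side pole).
Local Notation act := (act side pole).

Lemma to_hexagonK z (b : bool) :
  from_hexagon b (to_hexagon z) = (z.1, if b then - `|z.2| else `|z.2|).
Proof.
rewrite /from_hexagon /to_hexagon /= !divr1.
rewrite (_ : 1 + _ - _ = focal_sum z); last by ring.
by rewrite focal_fst focal_snd sqrtr_sqr.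
Qed.

Lemma hexagon_bounds v : hexagon v -> v.2 = 1 ->
  1 <= 1 + v.1.2 - lower v.1.1 /\ -1 <= v.1.1 <= 1.
Proof.
move=> [v0 _] h1.
have := v0 (@Ordinal 6 0 isT); have := v0 (@Ordinal 6 1 isT).
have := v0 (@Ordinal 6 2 isT); have := v0 (@Ordinal 6 3 isT).
have := v0 (@Ordinal 6 4 isT); have := v0 (@Ordinal 6 5 isT).
rewrite /side /= h1; case: (lowerP v.1.1) => [[]|| ] -> ? ? ? ? ? ?;
  by split; [lra|apply/andP; split; lra].
Qed.

Lemma hexagon_prod_ge0 v : hexagon v -> v.2 = 1 ->
  0 <= ((1 + v.1.2 - lower v.1.1) ^+ 2 - 1) * (1 - v.1.1 ^+ 2).
Proof.
move=> vP h1; have [s1 d1] := hexagon_bounds vP h1.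
rewrite mulr_ge0// subr_ge0 ?exprn_ege1//.
by rewrite -(@real_normK _ v.1.1) ?num_real// exprn_ile1// ler_norml.
Qed.

Lemma from_hexagonK v (b : bool) : hexagon v -> v.2 = 1 ->
  to_hexagon (from_hexagon b v) = v.
Proof.
move=> vP h1; have [s1 d1] := hexagon_bounds vP h1.
have p0 := hexagon_prod_ge0 vP h1.
have := @focal_coords R _ _ (from_hexagon b v) s1 d1.
rewrite /to_hexagon /from_hexagon h1 !divr1 /= => /(_ erefl)[|-> ->].
  by case: b; rewrite ?sqrrN sqr_sqrtr.
case: v h1 {vP s1 d1 p0} => [[x y] h] /= ->; congr (_, _, _); ring.
Qed.

Lemma from_hexagon_real v b : hexagon v -> v.2 = 1 ->
  (from_hexagon b v).2 = 0 -> 1 + v.1.2 - lower v.1.1 = 1 \/ v.1.1 = 1 \/ v.1.1 = -1.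
Proof.
move=> vP h1; have [s1 _] := hexagon_bounds vP h1.
have p0 := hexagon_prod_ge0 vP h1.
rewrite /from_hexagon h1 !divr1 /= => y0.
have : Num.sqrt (((1 + v.1.2 - lower v.1.1) ^+ 2 - 1) * (1 - v.1.1 ^+ 2)) == 0.
  by move: y0; case: b => /eqP; rewrite ?oppr_eq0.
rewrite sqrtr_eq0 => p0'.
have : ((1 + v.1.2 - lower v.1.1) ^+ 2 - 1) * (1 - v.1.1 ^+ 2) == 0.
  by rewrite eq_le p0 p0'.
rewrite mulf_eq0 !subr_eq0 sqrf_eq1 [1 == _]eq_sym sqrf_eq1 -!orbA.
move=> /or4P[]/eqP e; [by left|by exfalso; lra|by right; left|by right; right].
Qed.

Lemma from_hexagon_real_wall v b : hexagon v -> v.2 = 1 ->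
  (from_hexagon b v).2 = 0 -> exists i, side i v = 0.
Proof.
move=> vP h1 /(from_hexagon_real vP h1) [e|[e|e]].
- case: (lowerP v.1.1) => [[]|| ] le.
  + by exists (@Ordinal 6 1 isT); rewrite /side /=; lra.
  + by exists (@Ordinal 6 2 isT); rewrite /side /=; lra.
  + by exists (@Ordinal 6 3 isT); rewrite /side /=; lra.
  + by exists (@Ordinal 6 4 isT); rewrite /side /=; lra.
- by exists (@Ordinal 6 5 isT); rewrite /side /=; lra.
- by exists (@Ordinal 6 0 isT); rewrite /side /=; lra.
Qed.

Lemma hexagonZ v (a : R) : 0 < a -> hexagon v -> hexagon (a *: v).
Proof.
move=> a0 [v0 vD]; split=> [i|i j ij]; rewrite !sideZ; first by rewrite mulr_ge0// ltW.
by rewrite -mulrDr mulr_gt0// vD.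
Qed.

Lemma from_hexagonZ v b (a : R) : a != 0 -> from_hexagon b (a *: v) = from_hexagon b v.
Proof.
move=> a0; rewrite /from_hexagon /= /GRing.scale /=.
have aE (x h : R) : a * x / (a * h) = x / h by rewrite invfM mulrACA divff// mul1r.
by rewrite !aE.
Qed.

Lemma hexagon_normalize v : hexagon v -> exists u (a : R),
  [/\ hexagon u, u.2 = 1, 0 < a & v = a *: u].
Proof.
move=> vP; have v2 := hexagon_height vP; exists (v.2^-1 *: v), v.2; split=> //.
- by apply: hexagonZ; rewrite ?invr_gt0.
- by rewrite /= /GRing.scale /= mulVf// gt_eqF.
- by rewrite scalerA divff ?scale1r// gt_eqF.
Qed.

(** On a side, at height 1, the focal sum is 1 or the focal difference is 1 or -1, so the point is
    real and the two half planes agree there. *)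
Lemma from_hexagon_wall i v : hexagon v -> side i v = 0 ->
  from_hexagon true v = from_hexagon false v.
Proof.
move=> /hexagon_normalize[u [a [uP u1 a0 ->]]].
rewrite sideZ => /eqP; rewrite mulf_eq0 gt_eqF//= => /eqP i0.
rewrite !from_hexagonZ ?gt_eqF//.
have [s1 /andP[d0 d1]] := hexagon_bounds uP u1.
have [l1 l2 l3 l4] := lower_ge u.1.1.
suff p0 : ((1 + u.1.2 - lower u.1.1) ^+ 2 - 1) * (1 - u.1.1 ^+ 2) = 0.
  by rewrite /from_hexagon u1 !divr1 p0 sqrtr0 oppr0.
apply/eqP; rewrite mulf_eq0 !subr_eq0 sqrf_eq1 [1 == _]eq_sym sqrf_eq1 -!orbA.
move: i0; case: i => -[|[|[|[|[|[|]]]]]] //= ?; rewrite /side /= ?u1 => i0; apply/or4P.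
- by apply: Or44; apply/eqP; lra.
- by apply: Or41; apply/eqP; lra.
- by apply: Or41; apply/eqP; lra.
- by apply: Or41; apply/eqP; lra.
- by apply: Or41; apply/eqP; lra.
- by apply: Or43; apply/eqP; lra.
Qed.

Lemma from_hexagonP v b : hexagon v -> ~ puncture (from_hexagon b v).
Proof.
move=> /hexagon_normalize[u [a [uP u1 a0 ->]]]; rewrite from_hexagonZ ?gt_eqF//.
move=> [z2]; have [s1 /andP[d0 d1]] := hexagon_bounds uP u1.
have := from_hexagon_real uP u1 z2; rewrite /from_hexagon u1 !divr1 /=.
have D j k := uP.2 (@inord 5 j) (@inord 5 k); rewrite /side /= in D.
(* The five pairs of sides meeting at the finite vertices; a puncture would make both sides of one
   pair vanish. *)
have D01 := D 0 1; have D12 := D 1 2; have D23 := D 2 3; have D34 := D 3 4.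
have D45 := D 4 5; rewrite -!val_eqE /= !inordK//= in D01 D12 D23 D34 D45.
have {}D01 := D01 isT; have {}D12 := D12 isT; have {}D23 := D23 isT.
have {}D34 := D34 isT; have {}D45 := D45 isT.
move: (u.1.1) (u.1.2) (lower u.1.1) (lowerP u.1.1) s1 d0 d1 {D} D01 D12 D23 D34 D45.
move=> x y l lP s1 x0 x1 D01 D12 D23 D34 D45 [s|[x'|x']].
- rewrite s mul1r => -[x'|[]x'|[]x']; case: lP => [[]|| ] lE; lra.
- by rewrite x' mulr1 => -[s|[]s|[]s]; case: lP => [[]|| ] lE; lra.
- by rewrite x' mulrN1 => -[s|[]s|[]s]; case: lP => [[]|| ] lE; lra.
Qed.

End HexagonCovering.

Section HexagonContinuity.
Variable R : realType.
Local Notation V := (R^o * R^o * R^o)%type.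
Implicit Types (v : V) (z : R * R) (i j : 'I_6).
Local Notation hexagon := (chamber (@side R)).

Lemma lower_continuous : continuous (@lower R).
Proof.
have ac (c d : R) : continuous (fun x : R^o => (c * x + d) / 3).
  move=> x; apply: cvgM; last exact: cvg_cst.
  by apply: cvgD; [apply: cvgM; [exact: cvg_cst|exact: cvg_id]|exact: cvg_cst].
move=> x; have -> : @lower R =
    (((fun x : R^o => (- 4 * x + - 1) / 3) \max (fun x => (- 1 * x + 0) / 3)) \max
    ((fun x => (1 * x + 0) / 3) \max (fun x => (4 * x + - 1) / 3))).
  apply/funext => y; rewrite /lower /=;
      congr (Num.max (Num.max _ _) (Num.max _ _)); ring.
by apply: continuous_max; apply: continuous_max; exact: ac.
Qed.

Lemma to_hexagon_continuous : continuous (@to_hexagon R).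
Proof.
have [sc dc] := focal_continuous R => z.
apply: (@pair_continuous_at _ _ _ 
  (fun z => (focal_diff z, focal_sum z - 1 + lower (focal_diff z)) : R^o * R^o)
  (cst (1 : R^o)));
  last exact: cst_continuous.
  apply: (@pair_continuous_at _ R^o R^o); first exact: dc.
  apply: cvgD; first by apply: cvgB; [exact: sc|exact: cvg_cst].
  by apply: (@continuous_comp _ _ _ (@focal_diff R));
      [exact: dc|exact: lower_continuous].
Qed.

Lemma from_hexagon_continuous b v : hexagon v -> {for v, continuous (from_hexagon b)}.
Proof.
move=> /hexagon_height v2.
have fc : {for v, continuous (fun v : V => v.2)} by exact: cvg_snd.
have xc : {for v, continuous (fun v : V => v.1.1)}.
  by apply: (@continuous_comp _ _ _ (fun v : V => v.1) fst); exact: cvg_fst.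
have yc : {for v, continuous (fun v : V => v.1.2)}.
  by apply: (@continuous_comp _ _ _ (fun v : V => v.1) snd);
      [exact: cvg_fst|exact: cvg_snd].
have ic : {for v, continuous (fun v : V => v.2^-1)} by apply: cvgV => //; rewrite gt_eqF.
have dc : {for v, continuous (fun v : V => v.1.1 / v.2)} by exact: cvgM.
have sc : {for v, continuous (fun v : V => 1 + v.1.2 / v.2 - lower (v.1.1 / v.2))}.
  apply: cvgB; first by apply: cvgD; [exact: cvg_cst|exact: cvgM].
  by apply: (@continuous_comp _ _ _ (fun v : V => v.1.1 / v.2)) => //; exact: lower_continuous.
have sq (f : V -> R) : {for v, continuous f} -> {for v, continuous (fun v => f v ^+ 2)}.
  move=> fc'; apply: (@continuous_comp _ _ _ f (fun x : R => x ^+ 2)) => //.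
  exact: exprn_continuous.
have rc : {for v, continuous (fun v : V =>
    Num.sqrt (((1 + v.1.2 / v.2 - lower (v.1.1 / v.2)) ^+ 2 - 1) * (1 - (v.1.1 / v.2) ^+ 2)))}.
  apply: (@continuous_comp _ _ _
      (fun v : V => ((1 + v.1.2 / v.2 - lower (v.1.1 / v.2)) ^+ 2 - 1) * (1 - (v.1.1 / v.2) ^+ 2))).
    by apply: cvgM; apply: cvgB; try exact: cvg_cst; exact: sq.
  exact: sqrt_continuous.
apply: pair_continuous_at; first exact: cvgM.
by case: b; [exact: cvgN|exact: rc].
Qed.

End HexagonContinuity.

Lemma abs_signed (R : realDomainType) (x : R) : (if x < 0 then - `|x| else `|x|) = x.
Proof. by case: ltrP => x0; [rewrite ltr0_norm// opprK|rewrite ger0_norm]. Qed.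

(** * The covering of the punctured plane by the tiled cone *)

Section Developing.
Variable R : realType.
Local Notation V := (R^o * R^o * R^o)%type.
Implicit Types (v : V) (z : R * R) (i j : 'I_6).
Local Notation side := (@side R).
Local Notation pole := (@pole R).
Local Notation hexagon := (chamber side).
Local Notation refl := (refl side pole).
Local Notation act := (act side pole).

Definition develop : V -> R * R := unfold side pole (@from_hexagon R).

(** The map [develop] is constant on rays, so one point of each ray is kept. The height is measured
    after folding, which makes the slice invariant under the group; it need not be convex, and
    homotopies use the full cone. *)
Definition cone_slice : set V :=
  [set v | tits_cone side pole v /\ (folded side pole v).2 = 1].

Lemma developE w v : hexagon (act w v) ->
  develop v = from_hexagon (odd (size w)) (act w v).
Proof.
exact: (unfoldE (@side_lin R) (@side_pole R) (@side_pole_le R) (@from_hexagon_wall R)).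
Qed.

Lemma develop_continuous v : tits_cone side pole v -> {for v, continuous develop}.
Proof.
apply: (unfold_continuous (@side_lin R) (@side_continuous R) (@side_pole R)
  (@side_pole_le R)); [exact: from_hexagon_continuous|exact: from_hexagon_wall].
Qed.

Lemma developP v : tits_cone side pole v -> ~ puncture (develop v).
Proof. by move=> [w wv]; rewrite (developE wv); exact: from_hexagonP. Qed.

Lemma cone_sliceP w v : hexagon (act w v) -> cone_slice v <-> (act w v).2 = 1.
Proof.
move=> wv; have [vE _] := foldedP (@side_lin R) (@side_pole R) (@side_pole_le R) wv.
by split=> [[_]|]; rewrite ?vE// => h; split; [exists w|rewrite vE].
Qed.

Definition lift_point i (t : bool) z : V :=
  if t then refl i (to_hexagon z) else to_hexagon z.

Lemma lift_pointN i t z : refl i (lift_point i t z) = lift_point i (~~ t) z.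
Proof. by case: t => //=; rewrite (reflK (@side_lin R) (@side_pole R)). Qed.

(** The bit compares the parity of [w] with the half plane of [z]; if they disagree, one more
    reflection, in the side [i], corrects the parity. *)
Lemma develop_lift_point i w z : ~ puncture z ->
  cone_slice (act (rev w) (lift_point i (odd (size w) (+) (z.2 < 0)) z)) /\
  develop (act (rev w) (lift_point i (odd (size w) (+) (z.2 < 0)) z)) = z.
Proof.
move=> zO; set t := _ (+) _; set e := act _ _.
pose w' := if t then i :: w else w.
have actw u : act w (act (rev w) u) = u.
  by rewrite -{1}[w]revK (act_revK (@side_lin R) (@side_pole R)).
have w'e : act w' e = to_hexagon z.
  rewrite /w' /e; case: (t) => /=; rewrite ?act_cons actw//.
  by rewrite (reflK (@side_lin R) (@side_pole R)).
have w'P : hexagon (act w' e) by rewrite w'e; exact: to_hexagonP.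
split; first by apply/(cone_sliceP w'P); rewrite w'e.
rewrite (developE w'P) w'e to_hexagonK.
have -> : odd (size w') = (z.2 < 0).
  by rewrite /w' /t; case: (z.2 < 0); case w2: (odd (size w)); rewrite /= ?w2.
by rewrite abs_signed -surjective_pairing.
Qed.

Lemma develop_surj z : ~ puncture z -> exists2 v, cone_slice v & develop v = z.
Proof.
move=> zO; have [vA vz] := @develop_lift_point 0 [::] z zO.
by exists (act (rev [::]) (lift_point 0 (odd (size ([::] : seq 'I_6)) (+) (z.2 < 0)) z)).
Qed.

(* The plane cut along all the sides other than [i]. *)
Definition slit_plane i : set (R * R) :=
  [set z | forall j, j != i -> 0 < side j (to_hexagon z)].

Lemma slit_plane_open i : open (slit_plane i).
Proof.
rewrite openE => z zi.
suff : \forall z' \near z, forall j, j != i -> 0 < side j (to_hexagon z') by [].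
apply: (@filter_forall _ _ (fun j z' => j != i -> 0 < side j (to_hexagon z')) (nbhs z)) => j.
have [->|ji] := eqVneq j i; first exact: nearW.
have jc : {for z, continuous (fun z => side j (to_hexagon z))}.
  apply: (@continuous_comp _ _ _ (@to_hexagon R)); first exact: to_hexagon_continuous.
  exact: side_continuous.
have zj : \forall z' \near z, 0 < side j (to_hexagon z').
  exact: near_gt0 jc (zi j ji).
by apply: filterS zj.
Qed.

Lemma slit_plane_cover z : ~ puncture z -> exists i, slit_plane i z.
Proof.
move=> /to_hexagonP[z0 zD].
have [[i i0]|zN] := pselect (exists i, side i (to_hexagon z) = 0).
  by exists i => j ji; have := zD _ _ ji; rewrite i0 addr0.
exists 0 => j _; rewrite lt_neqAle z0 andbT; apply/eqP => j0.
by apply: zN; exists j.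
Qed.

Lemma slit_planeP i z : slit_plane i z -> ~ puncture z.
Proof.
move=> zi; have zP : hexagon (to_hexagon z).
  split=> [j|j k jk]; first exact: side_to_hexagon_ge0.
  have [ji|ji] := eqVneq j i.
    by rewrite ltr_wpDl ?side_to_hexagon_ge0// zi// -ji eq_sym.
  by rewrite ltr_wpDr ?side_to_hexagon_ge0// zi.
rewrite -[z](_ : from_hexagon (z.2 < 0) (to_hexagon z) = z); first exact: from_hexagonP.
by rewrite to_hexagonK abs_signed -surjective_pairing.
Qed.

Lemma slit_plane_real i z : slit_plane i z -> ~ puncture z -> z.2 = 0 ->
  side i (to_hexagon z) = 0.
Proof.
move=> zi zO z2; have zP := to_hexagonP zO.
have [//||j j0] := @from_hexagon_real_wall R _ false zP.
  by rewrite to_hexagonK /= z2 normr0.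
have [<-//|ji] := eqVneq j i; by have := zi j ji; rewrite j0 ltxx.
Qed.

(** In the slit plane a real point lies on the side [i], which the reflection fixes: the two
    branches agree along the real line. *)
Lemma lift_point_real i z t : slit_plane i z -> ~ puncture z -> z.2 = 0 ->
  lift_point i t z = to_hexagon z.
Proof.
move=> zi zO z2; case: t => //=.
by rewrite refl_wall//; exact: slit_plane_real.
Qed.

(** The bit is false unless the point is real, and there both values of the bit give the same
    lift. *)
Lemma lift_point_from_hexagon i (b : bool) v : hexagon v -> v.2 = 1 ->
  slit_plane i (from_hexagon b v) ->
  lift_point i (b (+) ((from_hexagon b v).2 < 0)) (from_hexagon b v) = v.
Proof.
move=> vP v1 bi; have bO := @from_hexagonP R v b vP.
rewrite -[RHS](@from_hexagonK R v b vP v1).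
have [b2|b2] := eqVneq (from_hexagon b v).2 0; first exact: lift_point_real.
rewrite (_ : _ (+) _ = false)//.
move: b2; rewrite /from_hexagon /=; set s := Num.sqrt _.
have : 0 <= s by exact: sqrtr_ge0.
by case: b {bi bO} => s0; rewrite ?oppr_eq0 ?oppr_lt0
    => sN0; [rewrite lt_neqAle eq_sym sN0 s0|rewrite ltNge s0].
Qed.

(** The plane slit along all sides but [i] is evenly covered: each sheet lies in a tile and its
    neighbour across the wall [i]. *)
Lemma develop_covering : covering cone_slice [set z | ~ puncture z] develop.
Proof.
move=> b bO; have [i bi] := slit_plane_cover bO.
exists (slit_plane i); first by split=> //; exact: slit_plane_open.
move=> e [[w we] e1] ei.
have {}e1 : (act w e).2 = 1 by apply/(cone_sliceP we); split=> //; exists w.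
pose s z := act (rev w) (lift_point i (odd (size w) (+) (z.2 < 0)) z).
have sE e' : hexagon (act w e') -> (act w e').2 = 1 -> slit_plane i (develop e') ->
    s (develop e') = e'.
  move=> we' e'1; rewrite (developE we') => e'i; rewrite /s.
  by rewrite lift_point_from_hexagon// (act_revK (@side_lin R) (@side_pole R)).
exists s; split; last 2 first.
- exact: sE.
- have near_slit : \forall e' \near e, slit_plane i (develop e').
    have := develop_continuous (ex_intro _ w we : tits_cone side pole e).
    by apply; apply: open_nbhs_nbhs; split; [exact: slit_plane_open|].
  have near_we := @act_continuous _ _ _ _ _ (@side_continuous R) w e _
    (near_chamber (@side_lin R) (@side_continuous R) (@side_pole R) we).
  apply: filterS2 near_slit near_we => e' e'i
      /= [e'P /(cone_sliceP e'P)|]; first by move=> e'1; exact: sE.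
  (* Here [e'] lies across a wall [k] through [e]. It must be [i], the only side left uncut in the
     slit plane containing [develop e]. *)
  move=> [k [k0 _ kP]] /(@cone_sliceP (k :: w) _ kP) k1.
  have ki : k = i.
    apply/eqP; apply/negPn/negP => ki; have := ei k ki.
    by rewrite (developE we) from_hexagonK// k0 ltxx.
  rewrite ki in kP k1.
  have dE : develop e' = from_hexagon (~~ odd (size w)) (act (i :: w) e') :=
    @developE (i :: w) _ kP.
  have zE : lift_point i (~~ odd (size w) (+) ((develop e').2 < 0)) (develop e') =
      act (i :: w) e' by rewrite dE lift_point_from_hexagon// -dE.
  suff lE : lift_point i (odd (size w) (+) ((develop e').2 < 0)) (develop e') = act w e'.
    by rewrite /s lE (act_revK (@side_lin R) (@side_pole R)).
  rewrite -[_ (+) _]negbK -addNb -lift_pointN zE act_cons.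
  exact: (reflK (@side_lin R) (@side_pole R)).
move=> z zi; have zO := slit_planeP zi.
have [sA sz] := @develop_lift_point i w z zO; split=> //.
have branch_continuous t : {for z, continuous (fun z => act (rev w) (lift_point i t z))}.
  apply: (@continuous_comp _ _ _ (lift_point i t)); last first.
    exact: (act_continuous (@side_continuous R)).
  case: t; last exact: to_hexagon_continuous.
  apply: (@continuous_comp _ _ _ (@to_hexagon R)); first exact: to_hexagon_continuous.
  exact: (refl_continuous (@side_continuous R)).
have snd_continuous : {for z, continuous (fun z : R * R => z.2)} by exact: cvg_snd.
move=> W sW.
(* Off the real line the choice of branch is locally constant. On it both branches have the same
   value, so both stay in [W] nearby. *)
have [z2|z2|z2] := ltrgtP z.2 0.
- have neg : \forall z' \near z, 0 < - z'.2.
    by apply: near_gt0; rewrite ?oppr_gt0//; exact: cvgN.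
  have sW' : nbhs (act (rev w) (lift_point i (odd (size w) (+) true) z)) W.
    by move: sW; rewrite /s z2.
  apply: filterS2 neg (branch_continuous _ _ sW') => z' z'2; rewrite oppr_gt0 in z'2.
  by rewrite /= /s z'2.
- have pos := near_gt0 snd_continuous z2.
  have sW' : nbhs (act (rev w) (lift_point i (odd (size w) (+) false) z)) W.
    by move: sW; rewrite /s (lt_gtF z2).
  apply: filterS2 pos (branch_continuous _ _ sW') => z' z'2.
  by rewrite /= /s (lt_gtF z'2).
have real_branch t : nbhs z ((fun z => act (rev w) (lift_point i t z)) @^-1` W).
  by apply: branch_continuous; move: sW; rewrite /s !(lift_point_real _ zi zO z2).
apply: filterS2 (real_branch true) (real_branch false) => z' Wt Wf.
by rewrite /= /s; case: (_ (+) _).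
Qed.

End Developing.

(** * The exponential *)

Section PolarCovering.
Variable R : realType.
Implicit Types (z w : R * R).

(* The complex exponential. *)
Definition polar w : R * R := (expR w.1 * cos w.2, expR w.1 * sin w.2).

Lemma polar_continuous : continuous polar.
Proof.
rewrite /polar => w; have f1 : {for w, continuous (fun w => expR w.1)}.
  apply: (@continuous_comp _ _ _ (fun w : R * R => w.1) expR); first exact: cvg_fst.
  exact: continuous_expR.
apply: (@pair_continuous_at _ _ _ (fun w : R * R => expR w.1 * cos w.2)
  (fun w => expR w.1 * sin w.2)); apply: cvgM => //.
  apply: (@continuous_comp _ _ _ (fun w : R * R => w.2) cos); first exact: cvg_snd.
  exact: continuous_cos.
apply: (@continuous_comp _ _ _ (fun w : R * R => w.2) sin); first exact: cvg_snd.
exact: continuous_sin.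
Qed.

Lemma polar_neq0 w : polar w <> (0, 0).
Proof.
move=> [c0 s0]; have e0 := expR_gt0 w.1.
have {}c0 : cos w.2 = 0 by apply/eqP; move/eqP: c0; rewrite mulf_eq0 gt_eqF.
have {}s0 : sin w.2 = 0 by apply/eqP; move/eqP: s0; rewrite mulf_eq0 gt_eqF.
by have := cos2Dsin2 w.2; rewrite c0 s0; lra.
Qed.

Lemma polar_surj z : z <> (0, 0) -> exists w, polar w = z.
Proof.
case: z => x y z0; pose rho := Num.sqrt (x ^+ 2 + y ^+ 2).
have rho2 : rho ^+ 2 = x ^+ 2 + y ^+ 2 by rewrite sqr_sqrtr// addr_ge0 ?sqr_ge0.
have rho0 : 0 < rho.
  rewrite lt_neqAle sqrtr_ge0 andbT eq_sym; apply/eqP => r0; apply: z0.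
  move/eqP: rho2; rewrite r0 expr0n /= eq_sym paddr_eq0 ?sqr_ge0// !sqrf_eq0.
  by move=> /andP[/eqP -> /eqP ->].
have c1 : -1 <= x / rho <= 1.
  rewrite ler_pdivlMr// ler_pdivrMr// mul1r mulN1r -ler_norml.
  by rewrite -sqrtr_sqr ler_wsqrtr// lerDl sqr_ge0.
have cE : cos (acos (x / rho)) = x / rho by rewrite acosK// in_itv.
have sE : sin (acos (x / rho)) = `|y| / rho.
  rewrite sin_acos// (_ : 1 - _ = (y / rho) ^+ 2); last first.
    by rewrite !expr_div_n rho2; field; rewrite -rho2 expf_neq0// gt_eqF.
  by rewrite sqrtr_sqr normrM normfV (gtr0_norm rho0).
exists (ln rho, if y < 0 then - acos (x / rho) else acos (x / rho)).
rewrite /polar /= lnK ?posrE//; case: ltrP => y0; rewrite ?cosN ?sinN cE sE.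
  by rewrite ltr0_norm// mulNr opprK ![rho * _]mulrC !divfK// gt_eqF.
by rewrite ger0_norm// ![rho * _]mulrC !divfK// gt_eqF.
Qed.

Lemma cos_sin_atan (rho p q : R) : 0 < rho -> 0 < p -> rho ^+ 2 = p ^+ 2 + q ^+ 2 ->
  rho * cos (atan (q / p)) = p /\ rho * sin (atan (q / p)) = q.
Proof.
move=> rho0 p0 rhoE; set a := atan _.
have c0 : 0 < cos a by apply: cos_gt0_pihalf; rewrite atan_gtNpi2 atan_ltpi2.
have sE : sin a * p = q * cos a.
  have -> : sin a = q / p * cos a by rewrite -[q / p]atanK /tan divfK// gt_eqF.
  by rewrite mulrAC divfK// gt_eqF.
have cE : rho * cos a = p.
  apply/eqP; rewrite -(@eqrXn2 _ 2)// ?mulr_ge0 ?ltW//; apply/eqP.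
  rewrite exprMn rhoE mulrDl -[q ^+ 2 * _]exprMn -sE exprMn.
  rewrite [sin a ^+ 2 * _]mulrC -mulrDr cos2Dsin2; ring.
split=> //; apply: (mulIf (lt0r_neq0 p0)); rewrite -mulrA sE -cE; ring.
Qed.

Section LocalAngle.
Variable t0 : R.

(* Coordinates of [z] in the orthonormal frame rotated by [t0]. *)
Definition dot z := z.1 * cos t0 + z.2 * sin t0.
Definition cross z := z.2 * cos t0 - z.1 * sin t0.
Definition angle z := atan (cross z / dot z).

Lemma dot_polar w : dot (polar w) = expR w.1 * cos (w.2 - t0).
Proof. by rewrite /dot /polar /= cosB; ring. Qed.

Lemma cross_polar w : cross (polar w) = expR w.1 * sin (w.2 - t0).
Proof. by rewrite /cross /polar /= sinB; ring. Qed.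

Lemma frame_norm z : z.1 ^+ 2 + z.2 ^+ 2 = dot z ^+ 2 + cross z ^+ 2.
Proof.
rewrite -[LHS]mul1r -(cos2Dsin2 t0) /dot /cross; ring.
Qed.

Lemma frame_coords z : z = (dot z * cos t0 - cross z * sin t0,
  dot z * sin t0 + cross z * cos t0).
Proof.
have c1 := cos2Dsin2 t0; rewrite [LHS]surjective_pairing /dot /cross.
by congr pair; rewrite -[LHS]mulr1 -c1; ring.
Qed.

Lemma dot_continuous : continuous dot.
Proof.
by move=> z; apply: cvgD; apply: cvgM; try exact: cvg_cst;
    [exact: cvg_fst|exact: cvg_snd].
Qed.

Lemma cross_continuous : continuous cross.
Proof.
by move=> z; apply: cvgB; apply: cvgM; try exact: cvg_cst;
    [exact: cvg_snd|exact: cvg_fst].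
Qed.

Lemma angle_continuous z : 0 < dot z -> {for z, continuous angle}.
Proof.
move=> z0; apply: (@continuous_comp _ _ _ (fun z => cross z / dot z));
    last exact: continuous_atan.
apply: cvgM; first exact: cross_continuous.
by apply: cvgV; [rewrite gt_eqF|exact: dot_continuous].
Qed.

Lemma angle_polar w (d : R) : - (pi / 2) < d < pi / 2 ->
  cos (w.2 - t0) = cos d -> sin (w.2 - t0) = sin d -> angle (polar w) = d.
Proof.
move=> dI cE sE; rewrite /angle dot_polar cross_polar cE sE.
by rewrite -mulf_div divff ?mul1r ?gt_eqF ?expR_gt0// tanK// in_itv.
Qed.

(** The angle of [w] and its principal value in the frame differ by a multiple of [2 * pi]; cosine
    and sine express this without naming an integer. *)
Lemma angle_lift w (d := w.2 - t0 - angle (polar w)) : 0 < dot (polar w) ->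
  cos d = 1 /\ sin d = 0.
Proof.
move=> w0; have [] := @cos_sin_atan (expR w.1) (dot (polar w)) (cross (polar w)).
- exact: expR_gt0.
- exact: w0.
- by rewrite dot_polar cross_polar !exprMn -mulrDr cos2Dsin2 mulr1.
rewrite -/(angle _) dot_polar cross_polar => /(mulfI (lt0r_neq0 (expR_gt0 _))) cE.
move=> /(mulfI (lt0r_neq0 (expR_gt0 _))) sE.
rewrite /d; move: (w.2 - t0) cE sE => a cE sE; rewrite cosB sinB cE sE.
by split; [rewrite -!expr2 cos2Dsin2|ring].
Qed.

End LocalAngle.

(** Branches of the logarithm exist over every open half plane bounded by a line through the
    origin. *)
Lemma polar_covering : covering setT [set z : R * R | z <> (0, 0)] polar.
Proof.
move=> b /polar_surj[[r0 t0] <-].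
exists [set z | 0 < dot t0 z].
  split; last by rewrite /= dot_polar /= subrr cos0 mulr1 expR_gt0.
  by apply: (@open_comp _ _ (dot t0) [set x | 0 < x]);
    [move=> z _; exact: dot_continuous|exact: open_gt].
(* The middle angle of the branch through [e], congruent to [t0] modulo [2 * pi]. *)
move=> e _ /= e0; pose d := e.2 - angle t0 (polar e).
have [dc ds] : cos (d - t0) = 1 /\ sin (d - t0) = 0.
  by have := angle_lift e0; rewrite /d addrAC.
exists (fun z => (ln (Num.sqrt (z.1 ^+ 2 + z.2 ^+ 2)), d + angle t0 z)).
have radius w : ln (Num.sqrt ((polar w).1 ^+ 2 + (polar w).2 ^+ 2)) = w.1.
  rewrite /polar /= !exprMn -mulrDr cos2Dsin2 mulr1 sqrtr_sqr gtr0_norm ?expR_gt0//.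
  exact: expRK.
split.
- move=> z /= z0.
  have zn : 0 < z.1 ^+ 2 + z.2 ^+ 2.
    by rewrite (frame_norm t0) ltr_wpDr ?sqr_ge0// exprn_gt0.
  split=> //.
    have [|//||cE sE]
        := @cos_sin_atan (Num.sqrt (z.1 ^+ 2 + z.2 ^+ 2)) (dot t0 z) (cross t0 z).
    - by rewrite sqrtr_gt0.
    - by rewrite sqr_sqrtr ?ltW// (frame_norm t0).
    rewrite /polar /= lnK ?posrE ?sqrtr_gt0//.
    rewrite -/(angle t0 z) in cE sE; rewrite [RHS](frame_coords t0) -cE -sE.
    have -> : d + angle t0 z = (d - t0) + (t0 + angle t0 z) by ring.
    rewrite [cos (d - t0 + _)]cosD [sin (d - t0 + _)]sinD dc ds (cosD t0) (sinD t0).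
    by congr pair; ring.
  apply: (@pair_continuous_at _ _ _ (fun z : R * R => ln (Num.sqrt (z.1 ^+ 2 + z.2 ^+ 2)))
     (fun z => d + angle t0 z)).
    apply: (@continuous_comp _ _ _ (fun z : R * R => Num.sqrt (z.1 ^+ 2 + z.2 ^+ 2)) (@ln R));
      last by apply: continuous_ln; rewrite sqrtr_gt0.
    apply: (@continuous_comp _ _ _ (fun z : R * R => z.1 ^+ 2 + z.2 ^+ 2));
        last exact: sqrt_continuous.
    apply: cvgD; first apply: (@continuous_comp _ _ _ (fun z : R * R => z.1)
        (fun x : R => x ^+ 2)).
    - exact: cvg_fst.
    - exact: exprn_continuous.
    - apply: (@continuous_comp _ _ _ (fun z : R * R => z.2) (fun x : R => x ^+ 2));
        first exact: cvg_snd.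
      exact: exprn_continuous.
  by apply: cvgD; [exact: cvg_cst|exact: angle_continuous].
- by rewrite radius /d subrK -surjective_pairing.
(* Near [e] the angle stays within [pi / 2] of [d], where the arctangent recovers it exactly. *)
have near_d : \forall w \near e, - (pi / 2) < w.2 - d < pi / 2.
  have aI : - (pi / 2) < e.2 - d < pi / 2.
    by rewrite /d opprB addrC subrK atan_gtNpi2 atan_ltpi2.
  have [lo hi] := andP aI.
  have c1 : {for e, continuous (fun w : R * R => w.2 - d - - (pi / 2))}.
    by do 2 (apply: cvgB; last exact: cvg_cst); exact: cvg_snd.
  have c2 : {for e, continuous (fun w : R * R => pi / 2 - (w.2 - d))}.
    by apply: cvgB; [exact: cvg_cst|apply: cvgB; [exact: cvg_snd|exact: cvg_cst]].
  have lo' : 0 < e.2 - d - - (pi / 2) by rewrite subr_gt0.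
  have hi' : 0 < pi / 2 - (e.2 - d) by rewrite subr_gt0.
  by apply: filterS2 (near_gt0 c1 lo') (near_gt0 c2 hi') => w; rewrite !subr_gt0 => -> ->.
apply: filterS near_d => w wd _; rewrite radius [RHS]surjective_pairing; congr pair.
have wE : w.2 - t0 = (w.2 - d) + (d - t0) by ring.
rewrite (@angle_polar _ _ (w.2 - d))//; first by ring.
- by rewrite wE cosD dc ds; ring.
- by rewrite wE sinD dc ds; ring.
Qed.

End PolarCovering.

(** * Triples *)

Section Triples.
Variable K : numFieldType.
Implicit Types (m g t : K) (z : 'rV[K^o]_3).

(* The triple with [m] the midpoint of the first two points, [g] their half
   difference, and the third one at [m + 3 t g]. *)
Definition triple m g t : 'rV[K^o]_3 :=
  \row_k (match val k with 0 => m - g | 1 => m + g | _ => m + 3 * t * g end).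

(** At [t = 0] the third point is the midpoint, at [3 * t = 1] or [-1] it meets the second or the
    first, and at [t = 1] or [-1] the second or the first is the midpoint. *)
Definition degenerate t : Prop :=
  [\/ t = 0, 3 * t = 1 \/ 3 * t = -1 | t = 1 \/ t = -1].

Definition no_progression z : Prop :=
  forall i j k, uniq [:: i; j; k] -> z 0 i + z 0 j <> 2 * z 0 k.

Definition mid z : K := (z 0 0 + z 0 1) / 2.
Definition gap z : K := (z 0 1 - z 0 0) / 2.
Definition ratio z : K := (z 0 2%:R - mid z) / (3 * gap z).

Lemma triple_coords z : gap z != 0 -> triple (mid z) (gap z) (ratio z) = z.
Proof.
move=> g0; apply/rowP => k; rewrite mxE.
have n2 : (2 : K) != 0 by rewrite pnatr_eq0.
have n3 : (3 : K) != 0 by rewrite pnatr_eq0.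
case: k => -[|[|[|//]]] i /=; rewrite /ratio /mid /gap in g0 *.
- rewrite (_ : Ordinal i = 0); [by field|exact: val_inj].
- rewrite (_ : Ordinal i = 1); [by field|exact: val_inj].
- rewrite (_ : Ordinal i = 2%:R); last exact: val_inj.
  have d0 : z 0 1 - z 0 0 != 0 by apply: contraNneq g0 => ->; rewrite mul0r.
  by field; rewrite ?d0 ?n2 ?n3.
Qed.

Lemma tripleP m g t : g != 0 -> ~ degenerate t ->
  injective (triple m g t 0) /\ no_progression (triple m g t).
Proof.
move=> g0 tN.
have n2 : (2 : K) != 0 by rewrite pnatr_eq0.
have n3 : (3 : K) != 0 by rewrite pnatr_eq0.
have t0 : t != 0 by apply/eqP => t0; apply: tN; apply: Or31.
have t3 : 3 * t - 1 != 0.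
  by rewrite subr_eq0; apply/eqP => t3; apply: tN; apply: Or32; left.
have t3' : 3 * t + 1 != 0.
  by rewrite addr_eq0; apply/eqP => t3'; apply: tN; apply: Or32; right.
have t1 : t - 1 != 0.
  by rewrite subr_eq0; apply/eqP => t1; apply: tN; apply: Or33; left.
have t1' : t + 1 != 0.
  by rewrite addr_eq0; apply/eqP => t1'; apply: tN; apply: Or33; right.
(* Each forbidden equality has a difference that factors into [g], nonzero constants and one of the
   nonzero quantities above. *)
have neq (a b c : K) : c != 0 -> a - b = c -> a <> b.
  by move=> c0 abc ab; move: c0; rewrite -abc ab subrr eqxx.
have d01 : m + g <> m - g by apply: (neq _ _ (2 * g)); [rewrite mulf_neq0|ring].
have d02 : m + 3 * t * g <> m - g.
  by apply: (neq _ _ (g * (3 * t + 1))); [rewrite mulf_neq0|ring].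
have d12 : m + 3 * t * g <> m + g.
  by apply: (neq _ _ (g * (3 * t - 1))); [rewrite mulf_neq0|ring].
have p01 : 2 * (m + 3 * t * g) <> (m - g) + (m + g).
  by apply: (neq _ _ (2 * (3 * (t * g)))); [rewrite !mulf_neq0|ring].
have p02 : (m - g) + (m + 3 * t * g) <> 2 * (m + g).
  by apply: (neq _ _ (3 * (g * (t - 1)))); [rewrite !mulf_neq0|ring].
have p12 : (m + g) + (m + 3 * t * g) <> 2 * (m - g).
  by apply: (neq _ _ (3 * (g * (t + 1)))); [rewrite !mulf_neq0|ring].
split.
  move=> [[|[|[|//]]] ?] [[|[|[|//]]] ?]; rewrite !mxE /= => e; apply: val_inj => //=;
  by [case: d01|case: d02|case: d12].
move=> [[|[|[|//]]] ?] [[|[|[|//]]] ?] [[|[|[|//]]] ?] //= _; rewrite !mxE /=.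
- by move/esym.
- exact: p02.
- by rewrite addrC => /esym.
- exact: p12.
- by rewrite addrC.
- by rewrite addrC.
Qed.

Lemma triple_coordsP z : injective (z 0) -> no_progression z ->
  gap z != 0 /\ ~ degenerate (ratio z).
Proof.
have n2 : (2 : K) != 0 by rewrite pnatr_eq0.
have n3 : (3 : K) != 0 by rewrite pnatr_eq0.
move=> z_inj zN; have g0 : gap z != 0.
  rewrite mulf_neq0 ?invr_eq0// subr_eq0.
  by apply/eqP => /z_inj/(congr1 val).
split=> //; have := triple_coords g0; move: (mid z) (gap z) (ratio z) g0 => m g t g0 zE.
have z0 : z 0 0 = m - g by rewrite -zE mxE.
have z1 : z 0 1 = m + g by rewrite -zE mxE.
have z2 : z 0 2%:R = m + 3 * t * g by rewrite -zE mxE.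
move=> [t0|[]t0|[]t0].
- by apply: (zN 0 1 2%:R) => //; rewrite z0 z1 z2 t0; ring.
- by have /z_inj/(congr1 val) : z 0 2%:R = z 0 1 by rewrite z1 z2 t0; ring.
- by have /z_inj/(congr1 val) : z 0 2%:R = z 0 0 by rewrite z0 z2 t0; ring.
- by apply: (zN 0 2%:R 1) => //; rewrite z0 z1 z2 t0; ring.
- by apply: (zN 1 2%:R 0) => //; rewrite z0 z1 z2 t0; ring.
Qed.

Lemma triple_continuous (T : topologicalType) (m g t : T -> K^o) x :
  {for x, continuous m} -> {for x, continuous g} -> {for x, continuous t} ->
  {for x, continuous (fun y => triple (m y) (g y) (t y))}.
Proof.
move=> mc gc tc; apply: row_continuous_at => -[[|[|[|//]]] i].
- rewrite (_ : (fun _ => _) = fun y => m y - g y); first exact: cvgB.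
  by apply/funext => y; rewrite mxE.
- rewrite (_ : (fun _ => _) = fun y => m y + g y); first exact: cvgD.
  by apply/funext => y; rewrite mxE.
- rewrite (_ : (fun _ => _) = fun y => m y + 3 * t y * g y).
    by apply: cvgD => //; apply: cvgM => //; apply: cvgM => //; exact: cvg_cst.
  by apply/funext => y; rewrite mxE.
Qed.

Lemma triple_coords_continuous z :
  [/\ {for z, continuous (mid : _ -> K^o)}, {for z, continuous (gap : _ -> K^o)} &
      gap z != 0 -> {for z, continuous (ratio : _ -> K^o)}].
Proof.
have cc i : {for z, continuous (fun z : 'rV[K^o]_3 => z 0 i)} by exact: row_coord_continuous.
have mc : {for z, continuous (mid : _ -> K^o)}.
  exact: (cvgM (cvgD (cc 0) (cc 1)) (cvg_cst _)).
have gc : {for z, continuous (gap : _ -> K^o)}.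
  exact: (cvgM (cvgB (cc 1) (cc 0)) (cvg_cst _)).
split=> // g0; apply: (cvgM (cvgB (cc _) mc)).
by apply: cvgV; [rewrite mulf_neq0 ?pnatr_eq0|exact: (cvgM (cvg_cst _) gc)].
Qed.

End Triples.

(** * The complex numbers as a real plane *)

Section ComplexPlane.
Variable R : realType.
Local Notation C := (R[i]^o).

Definition to_complex (z : R * R) : C := Complex z.1 z.2.
Definition of_complex (c : C) : R * R := (complex.Re c, complex.Im c).

Lemma to_complexK z : of_complex (to_complex z) = z.
Proof. by case: z. Qed.

Lemma of_complexK c : to_complex (of_complex c) = c.
Proof. by case: c. Qed.

Lemma of_complex_continuous : continuous of_complex.
Proof.
rewrite /of_complex => c.
have part (f : C -> R) : (forall a b, f (a - b) = f a - f b) ->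
    (forall a, `|f a| <= Num.sqrt (complex.Re a ^+ 2 + complex.Im a ^+ 2)) ->
    {for c, continuous f}.
  move=> fB f_le W /nbhs_ballP[e /= e0 eW]; apply/nbhs_ballP; exists (e%:C)%C.
    by rewrite /= ltcR.
  move=> c' /= cc'; apply: eW; move: cc'; rewrite /ball /= normc_def ltcR -fB.
  exact: le_lt_trans.
apply: (@pair_continuous_at _ _ _ (@complex.Re R : C -> R) (@complex.Im R : C -> R)).
  apply: part => [a b|a]; first by rewrite raddfB.
  by rewrite -sqrtr_sqr ler_wsqrtr// lerDl sqr_ge0.
apply: part => [a b|a]; first by rewrite raddfB.
by rewrite -sqrtr_sqr ler_wsqrtr// lerDr sqr_ge0.
Qed.

Lemma to_complex_continuous : continuous to_complex.
Proof.
move=> z W /nbhs_ballP[e /= e0 eW].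
have [r r0 re] : exists2 r : R, 0 < r & e = (r%:C)%C.
  move: e0; rewrite ltcE /= => /andP[/eqP im0 re0].
  by exists (complex.Re e) => //; case: e {eW} im0 re0 => a b /= -> _.
apply/nbhs_ballP; exists (r / 2); first by rewrite /= divr_gt0.
move=> [x' y'] [/= xx' yy']; apply: eW; rewrite re.
move: xx' yy'; rewrite /ball /= => xx' yy'.
rewrite normc_def ltcR /=; apply: le_lt_trans (_ : _ <= `|z.1 - x'| + `|z.2 - y'|) _.
  rewrite -[leRHS]ger0_norm ?addr_ge0// -sqrtr_sqr ler_wsqrtr//.
  rewrite -(@real_normK _ (z.1 - x')) ?num_real// -(@real_normK _ (z.2 - y')) ?num_real//.
  by have := normr_ge0 (z.1 - x'); have := normr_ge0 (z.2 - y'); nra.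
by rewrite [r]splitr ltrD.
Qed.

Lemma puncture_complex c : puncture (of_complex c) <-> degenerate c.
Proof.
have toE (z : R * R) : c = to_complex z <-> of_complex c = z.
  by split=> [->|<-]; rewrite ?to_complexK ?of_complexK.
have thirdE (x : R) : 3 * c = to_complex (x, 0) <-> of_complex c = (x / 3, 0).
  rewrite -toE; have -> : to_complex (x, 0) = 3 * to_complex (x / 3, 0).
    by apply/eqP; rewrite eq_complex /=; apply/andP; split; apply/eqP; field.
  by split=> [/mulfI|->//]; apply; rewrite pnatr_eq0.
have c0 : c = 0 <-> of_complex c = (0, 0) by rewrite -toE.
have c1 : c = 1 <-> of_complex c = (1, 0) by rewrite -toE.
have cN1 : c = -1 <-> of_complex c = (-1, 0).
  by rewrite -toE (_ : -1 = to_complex (-1, 0))//; apply/eqP; rewrite eq_complex /= oppr0 !eqxx.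
have c3 : 3 * c = 1 <-> of_complex c = (1 / 3, 0) by rewrite -thirdE.
have cN3 : 3 * c = -1 <-> of_complex c = (- (1 / 3), 0).
  rewrite -mulNr -thirdE (_ : -1 = to_complex (-1, 0))//.
  by apply/eqP; rewrite eq_complex /= oppr0 !eqxx.
rewrite /puncture /degenerate (propext c0) (propext c1) (propext cN1) (propext c3) (propext cN3);
    case: (of_complex c) => x y /=.
split=> [[->]|[[-> ->]|[] [-> ->]|[] [-> ->]]].
- by move=> [->|[]->|[]->]; [apply: Or31|apply: Or32; left|apply: Or32; right|
    apply: Or33; left|apply: Or33; right].
- by split=> //; apply: Or31.
- by split=> //; apply: Or32; left.
- by split=> //; apply: Or32; right.
- by split=> //; apply: Or33; left.
- by split=> //; apply: Or33; right.
Qed.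

End ComplexPlane.

(** * The convex set above the space of triples *)

Section NonProgressions.
Variable R : realType.
Local Notation X := (non_AP_triples R).
Local Notation ordered := (ordered_config R 3).
Local Notation pic := (\pi_(config R 3) : ordered -> config R 3).
Local Notation W := (R^o * R^o)%type.
Local Notation V := (R^o * R^o * R^o)%type.
Local Notation cone := (tits_cone (@side R) (@pole R)).
Implicit Types (p : W * W * V).

Lemma pi_non_AP (z : ordered) :
  (~` @arithmetic_progression R) (pic z) <-> no_progression (set_val z).
Proof.
split=> [zN i j k ijk e|zN [z' [/pi_config_eq[s ->] [i [j [k [ijk e]]]]]]].
  by apply: zN; exists z; split=> //; exists i, j, k.
apply: (zN (s i) (s j) (s k)); last by move: e; rewrite !mxE.
by move: ijk; rewrite /= !inE !(inj_eq perm_inj).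
Qed.

(* The value off the cone is arbitrary, but must avoid the punctures. *)
Definition develop_total (v : V) : R * R :=
  if `[< cone v >] then develop v else (0, 1).

Lemma develop_totalP v : ~ puncture (develop_total v).
Proof.
rewrite /develop_total; case: asboolP => [|_]; first exact: developP.
by move=> [/eqP]; rewrite oner_eq0.
Qed.

Definition cover_row p : 'rV[R[i]^o]_3 := triple (to_complex p.1.1)
  (to_complex (polar p.1.2)) (to_complex (develop_total p.2)).

Lemma cover_rowP p : injective (cover_row p 0) /\ no_progression (cover_row p).
Proof.
apply: tripleP.
  apply/eqP => /(congr1 (@of_complex R)); rewrite to_complexK; exact: polar_neq0.
by move=> /puncture_complex; rewrite to_complexK; exact: develop_totalP.
Qed.

Definition cover_config p : ordered :=
  SigSub (mem_set ((cover_rowP p).1 : ordered_config R 3 (cover_row p))).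

(** Total thanks to [develop_total]; continuity is established over the cone only. *)
Definition cover_map p : X :=
  SigSub (mem_set ((pi_non_AP (cover_config p)).2 (cover_rowP p).2)).

Lemma cover_map_continuous p : cone p.2 -> {for p, continuous cover_map}.
Proof.
move=> pc; apply: set_type_continuous_at.
apply: (@continuous_comp _ _ _ cover_config pic); last exact: pi_continuous.
apply: set_type_continuous_at; rewrite /comp /= /cover_row.
apply: (@triple_continuous R[i]).
- apply: (@continuous_comp _ _ _ (fun p : W * W * V => p.1.1) (@to_complex R));
    last exact: to_complex_continuous.
  by apply: (@continuous_comp _ _ _ (fun p : W * W * V => p.1) fst); exact: cvg_fst.
- apply: (@continuous_comp _ _ _ (fun p : W * W * V => polar p.1.2) (@to_complex R));
    last exact: to_complex_continuous.
  apply: (@continuous_comp _ _ _ (fun p : W * W * V => p.1.2) (@polar R));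
      last exact: polar_continuous.
  by apply: (@continuous_comp _ _ _ (fun p : W * W * V => p.1) snd);
      [exact: cvg_fst|exact: cvg_snd].
- apply: (@continuous_comp _ _ _ (fun p : W * W * V => develop_total p.2) (@to_complex R));
    last exact: to_complex_continuous.
  apply: (@continuous_comp _ _ _ (fun p : W * W * V => p.2) develop_total);
      first exact: cvg_snd.
  (* The cone is open, so the default value does not occur near [p]. *)
  move=> S; rewrite {1}/develop_total asboolT// => pS.
  have near_cone := near_tits_cone (@side_lin R) (@side_continuous R) (@side_pole R) pc.
  have := develop_continuous pc pS.
  by apply: filterS2 near_cone => v vc; rewrite /= /develop_total asboolT.
Qed.

Lemma cover_map_row p (z : ordered) (x : X) :
  cover_row p = set_val z -> pic z = set_val x -> cover_map p = x.
Proof.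
move=> pz zx; have pE : cover_config p = z by exact: val_inj.
by apply: val_inj; rewrite /= pE; exact: zx.
Qed.

Lemma ordered_coords (z : ordered) : no_progression (set_val z) ->
  [/\ of_complex (gap (set_val z)) <> (0, 0),
      ~ puncture (of_complex (ratio (set_val z))) &
      forall p, p.1.1 = of_complex (mid (set_val z)) ->
        polar p.1.2 = of_complex (gap (set_val z)) ->
        develop_total p.2 = of_complex (ratio (set_val z)) -> cover_row p = set_val z].
Proof.
move=> zN; have [g0 tN] := triple_coordsP (set_valP z) zN; split.
- move=> /(congr1 (@to_complex R)); rewrite of_complexK; exact/eqP.
- by move=> /puncture_complex.
- by move=> p pm pg pt; rewrite /cover_row pm pg pt !of_complexK; exact: triple_coords.
Qed.

Lemma cover_map_surj x : exists2 p, cone p.2 & cover_map p = x.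
Proof.
have zx := reprK (set_val x : config R 3); set z := repr _ in zx.
have zN : no_progression (set_val z) by apply/pi_non_AP; rewrite zx; exact: set_valP.
have [/polar_surj[w wz] /develop_surj[v [vc _] vz] zE] := ordered_coords zN.
exists (of_complex (mid (set_val z)), w, v) => //.
by apply: cover_map_row zx; apply: zE => //=; rewrite /develop_total asboolT.
Qed.

(** Every point is joined to [x0] by the image of a segment in the convex set above. *)
Lemma non_AP_connected : connected [set: X].
Proof.
(* Any inhabitant will do, but [0] is not in the cone; the segments start from another preimage
   [p0]. *)
have [x0 _] : exists x : X, True by exists (cover_map 0).
have [p0 p0c p0x] := cover_map_surj x0.
pose seg p (r : R^o) := cover_map (r *: p + (1 - r) *: p0).
rewrite (_ : [set: X] = \bigcup_(p in [set p | cone p.2]) (seg p @` `[0, 1]%classic)).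
  apply: bigcup_connected.
    exists x0 => p pc; exists 0; first by rewrite /= in_itv/= lexx ler01.
    by rewrite /seg scale0r add0r subr0 scale1r.
  move=> p pc; apply: connected_continuous_connected; first exact: segment_connected.
  apply: continuous_in_subspaceT => r; rewrite inE /= in_itv/= => r01.
  apply: (@continuous_comp R^o _ _ (fun r : R^o => r *: p + (1 - r) *: p0)).
    apply: cvgD; first by apply: cvgZr_tmp; exact: cvg_id.
    by apply: cvgZr_tmp; apply: cvgB; [exact: cvg_cst|exact: cvg_id].
  apply: cover_map_continuous.
  exact: (tits_cone_convex (@side_lin R) (@side_pole R) (@side_pole_le R)).
apply/seteqP; split=> // x _; have [p pc px] := cover_map_surj x.
exists p => //; exists 1; first by rewrite /= in_itv/= lexx ler01.
by rewrite /seg scale1r subrr scale0r addr0.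
Qed.

End NonProgressions.

(** * Lifting spheroids *)

Section Lifting.
Variable R : realType.
Local Notation X := (non_AP_triples R).
Local Notation ordered := (ordered_config R 3).
Local Notation pic := (\pi_(config R 3) : ordered -> config R 3).
Local Notation W := (R^o * R^o)%type.
Local Notation V := (R^o * R^o * R^o)%type.
Local Notation cone := (tits_cone (@side R) (@pole R)).

Definition clamp_in n (t : 'rV[R]_n) : cube R n := SigSub (mem_set (clamp_cube t)).

Lemma clamp_in_continuous n : continuous (@clamp_in n).
Proof. by move=> t; apply: set_type_continuous_at; exact: clamp_continuous. Qed.

Lemma clamp_in_val n (t : cube R n) : clamp_in (set_val t) = t.
Proof. by apply: val_inj; rewrite /= clamp_id//; exact: set_valP. Qed.

Lemma clamp_boundary n (t : 'rV[R]_n) : (exists i, t 0 i = 0 \/ t 0 i = 1) ->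
  cube_boundary (clamp_in t).
Proof.
move=> [i ti]; exists i; rewrite /= mxE.
by case: ti => ->; [left|right]; rewrite ?(min_r ler01) ?maxxx// minxx (max_r ler01).
Qed.

Lemma spheroid_lift n (E B : topologicalType) (A : set E) (O : set B) (p : E -> B)
    (f : 'rV[R]_n -> B) (b : B) (e0 : E) :
  (1 < n)%N -> hausdorff_space E -> covering A O p -> continuous f ->
  (forall t, cube R n t -> O (f t)) ->
  (forall t, cube R n t -> (exists i, t 0 i = 0 \/ t 0 i = 1) -> f t = b) ->
  A e0 -> p e0 = b ->
  exists G : 'rV[R]_n -> E, [/\ continuous G, forall t, A (G t),
    forall t, cube R n t -> p (G t) = f t &
    forall t, cube R n t -> (exists i, t 0 i = 0 \/ t 0 i = 1) -> G t = e0].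
Proof.
move=> n1 hE pc fc fO fb Ae0 pe0.
have f0 : f 0 = b.
  apply: fb; first exact: cube0.
  by exists (Ordinal (ltnW n1)); left; rewrite mxE.
have [|G [Gc GA pG G0]] := cube_lift hE pc fc fO Ae0; first by rewrite pe0 f0.
have pGt t : cube R n t -> p (G t) = f t by move=> tc; rewrite pG clamp_id.
exists G; split=> // t tc tb; rewrite -G0.
have Ob : O b by rewrite -f0; apply: fO; exact: cube0.
apply: (lift_boundary_const hE pc n1 Ob Gc GA) tc tb.
by move=> u uc ub; rewrite pGt// fb.
Qed.

(** The point [p0] precedes [f], so that all spheroids get lifts with one boundary value. The lift
    is made in stages: order the points, take the midpoint, half difference and ratio, then lift the
    last two through [polar] and [develop]. *)
Lemma cover_map_lift n (x0 : X) : (1 < n)%N -> exists p0 : W * W * V,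
  forall f : cube R n -> X, spheroid x0 f ->
  exists F : 'rV[R]_n -> W * W * V, [/\ continuous F,
    forall t, cone (F t).2,
    forall t : cube R n, cover_map (F (set_val t)) = f t &
    forall t : cube R n, cube_boundary t -> F (set_val t) = p0].
Proof.
move=> n1.
have z0x := reprK (set_val x0 : config R 3); set z0 := repr _ in z0x.
have z0N : no_progression (set_val z0) by apply/pi_non_AP; rewrite z0x; exact: set_valP.
have [/polar_surj[w0 w0z] /develop_surj[v0 v0A v0z] _] := ordered_coords z0N.
exists (of_complex (mid (set_val z0)), w0, v0) => f [fc fb].
pose f1 t : config R 3 := set_val (f (clamp_in t)).
have [|||||Z [Zc _ piZ Zb]] := @spheroid_lift n _ _ setT setT pic f1 (set_val x0) z0 n1
    (@ordered_hausdorff R 3) (@config_covering R 3).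
- move=> t; apply: (@continuous_comp _ _ _ (fun t => f (clamp_in t)) set_val);
    last exact: initial_continuous.
  by apply: (@continuous_comp _ _ _ (@clamp_in n));
      [exact: clamp_in_continuous|exact: fc].
- by [].
- by move=> t _ tb; rewrite /f1 fb//; exact: clamp_boundary.
- by [].
- exact: z0x.
(* The lift [Z] is controlled only over the cube; composing with [clamp] keeps every [z t] free of
   progressions. *)
pose z t := set_val (Z (clamp t)).
have zN t : no_progression (z t).
  apply/pi_non_AP; rewrite piZ; [exact: set_valP|exact: clamp_cube].
have zc : continuous z.
  move=> t; apply: (@continuous_comp _ _ _ (fun t => Z (clamp t)) set_val);
    last exact: initial_continuous.
  by apply: (@continuous_comp _ _ _ (@clamp R n)); [exact: clamp_continuous|exact: Zc].
have zb t : cube R n t -> (exists i, t 0 i = 0 \/ t 0 i = 1) -> z t = set_val z0.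
  by move=> tc tb; rewrite /z clamp_id// Zb.
have z_coord t := ordered_coords (zN t).
have [midc gapc ratioc] : [/\ continuous (fun t => of_complex (mid (z t))),
    continuous (fun t => of_complex (gap (z t))) &
    continuous (fun t => of_complex (ratio (z t)))].
  split=> t; have [mc gc rc] := @triple_coords_continuous R[i] (z t).
  - apply: (@continuous_comp _ _ _ (fun t => mid (z t)) (@of_complex R));
      last exact: of_complex_continuous.
    by apply: (@continuous_comp _ _ _ z (@mid R[i])); [exact: zc|exact: mc].
  - apply: (@continuous_comp _ _ _ (fun t => gap (z t)) (@of_complex R));
      last exact: of_complex_continuous.
    by apply: (@continuous_comp _ _ _ z (@gap R[i])); [exact: zc|exact: gc].
  - apply: (@continuous_comp _ _ _ (fun t => ratio (z t)) (@of_complex R));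
      last exact: of_complex_continuous.
    apply: (@continuous_comp _ _ _ z (@ratio R[i])); first exact: zc.
    by apply: rc; have [] := triple_coordsP (set_valP (Z (clamp t))) (zN t).
have [|||||G [Gc _ polarG Gb]] := @spheroid_lift n (R * R)%type _ setT _ (@polar R)
    (fun t => of_complex (gap (z t))) (of_complex (gap (set_val z0))) w0 n1 _
    (@polar_covering R) gapc.
- exact: norm_hausdorff.
- by move=> t _; have [] := z_coord t.
- by move=> t tc tb; rewrite zb.
- by [].
- exact: w0z.
have [|||||H [Hc HA devH Hb]] := @spheroid_lift n V _ _ _ (@develop R)
    (fun t => of_complex (ratio (z t))) (of_complex (ratio (set_val z0))) v0 n1 _
    (@develop_covering R) ratioc.
- exact: norm_hausdorff.
- by move=> t _; have [] := z_coord t.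
- by move=> t tc tb; rewrite zb.
- exact: v0A.
- exact: v0z.
exists (fun t => (of_complex (mid (z t)), G t, H t)); split.
- move=> t; apply: (@pair_continuous_at _ _ _ (fun t => (of_complex (mid (z t)), G t) : W * W) H);
    last exact: Hc.
  by apply: (@pair_continuous_at _ W W); [exact: midc|exact: Gc].
- by move=> t; have [] := HA t.
- move=> t; have tc : cube R n (set_val t) by exact: set_valP.
  apply: (@cover_map_row _ _ (Z (clamp (set_val t)))).
    have [_ _] := z_coord (set_val t); apply => /=; [by []|exact: polarG|].
    by rewrite /develop_total asboolT ?devH//; have [] := HA (set_val t).
  by rewrite piZ; [rewrite /f1 clamp_id// clamp_in_val|exact: clamp_cube].
- move=> t tb; have tc : cube R n (set_val t) by exact: set_valP.
  by rewrite zb// Gb// Hb.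
Qed.

(** Both lifts equal [p0] on the boundary, so the segments between them are constant there and the
    homotopy is relative to the boundary. *)
Lemma spheroids_homotopic n (x0 : X) (f g : cube R n -> X) : (1 < n)%N ->
  spheroid x0 f -> spheroid x0 g -> spheroid_homotopic x0 f g.
Proof.
move=> n1 fP gP; have [p0 lift] := @cover_map_lift n x0 n1.
have [F [Fc Fcone Ff Fb]] := lift f fP; have [G [Gc Gcone Gg Gb]] := lift g gP.
pose path (ts : cube R n * @unit_itv R) :=
  (set_val ts.2 : R) *: G (set_val ts.1) + (1 - (set_val ts.2 : R)) *: F (set_val ts.1).
exists (@cover_map R \o path); split.
- move=> ts; apply: continuous_comp; last first.
    apply: cover_map_continuous.
    apply: (tits_cone_convex (@side_lin R) (@side_pole R) (@side_pole_le R)) => //.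
    by have := set_valP ts.2; rewrite /unit_itv /= in_itv.
  have sc : {for ts, continuous (fun ts : cube R n * @unit_itv R => set_val ts.2 : R^o)}.
    apply: (@continuous_comp _ _ _ (fun ts : cube R n * @unit_itv R => ts.2) set_val).
      exact: cvg_snd.
    exact: initial_continuous.
  have tc : {for ts, continuous (fun ts : cube R n * @unit_itv R => set_val ts.1)}.
    apply: (@continuous_comp _ _ _ (fun ts : cube R n * @unit_itv R => ts.1) set_val).
      exact: cvg_fst.
    exact: initial_continuous.
  apply: cvgD; apply: cvgZ.
  - exact: sc.
  - by apply: (@continuous_comp _ _ _ (fun ts : cube R n * @unit_itv R => set_val ts.1) G);
      [exact: tc|exact: Gc].
  - by apply: cvgB; [exact: cvg_cst|exact: sc].
  - by apply: (@continuous_comp _ _ _ (fun ts : cube R n * @unit_itv R => set_val ts.1) F);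
      [exact: tc|exact: Fc].
- by move=> t s s0; rewrite /= /path /= s0 scale0r add0r subr0 scale1r Ff.
- by move=> t s s1; rewrite /= /path /= s1 scale1r subrr scale0r addr0 Gg.
- move=> t s tb; rewrite /= /path /= Fb// Gb// -scalerDl addrC subrK scale1r.
  by rewrite -(Fb t tb) Ff; case: fP => _; apply.
Qed.

End Lifting.

Theorem corollary1p7 (R : realType) : is_K_pi_1 R (non_AP_triples R).
Proof.
split; first by exists (@cover_map R 0).
  exact: non_AP_connected.
move=> n x0 n2.
have const_spheroid : spheroid x0 (fun _ : cube R n => x0).
  by split=> // t; exact: cst_continuous.
(* All spheroids at [x0] are homotopic, so every class is the set of all of them. *)
have classE (f : cube R n -> non_AP_triples R)
    : spheroid x0 f -> spheroid_class x0 f = spheroid (n := n) x0.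
  move=> fP; apply/seteqP; split=> [g [] //|g gP]; split=> //.
  exact: spheroids_homotopic.
apply/seteqP; split=> [_ [f fP <-]|_ ->]; last by exists (fun=> x0).
by rewrite /= classE// classE.
Qed.
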